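(* ${\sf VS}$ interprets Robinson's theory ${\sf R}$, i.e. ${\sf VS}\rhd {\sf R}$, via a one-dimensional interpretation.
   Context: ${\sf VS}$ (Vaught set theory) is the theory in the language $\{\in\}$ with axioms $\exists x\,\forall y\, y\notin x$ and, for every $n$, $\forall u_0\dots\forall u_{n-1}\,\exists x\,\forall y\,(y\in x\leftrightarrow \bigvee_{i<n} y=u_i)$ (no extensionality). ${\sf R}$ is the weak arithmetic of Tarski, Mostowski and Robinson (in the language with $0$, successor ${\sf S}$, $+$, $\times$, with $\leq$ defined by $x\le y:\leftrightarrow\exists z\,(z+x=y)$), axiomatized by the numeral equations for $+$ and $\times$, the inequalities between distinct numerals, and for each $n$: $x\le \underline n\to\bigvee_{k\le n}x=\underline k$ and $x\le\underline n\vee\underline n\le x$. *)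

(* Defs.v *)
From mathcomp Require Import all_boot.
From Stdlib Require List.

Set Implicit Arguments.
Unset Strict Implicit.
Unset Printing Implicit Defensive.

(* Classical one-sorted first-order logic with identity, with de Bruijn
   indices, built from falsum, implication and the universal quantifier. *)

Record signature := Signature {
  fsym : Type; far : fsym -> nat;
  rsym : Type; rar : rsym -> nat }.
Arguments far {s} _.
Arguments rar {s} _.

Inductive term (S : signature) : Type :=
| Var of nat
| App (f : fsym S) of {ffun 'I_(far f) -> term S}.
Arguments Var {S} _.
Arguments App {S} f _.

Inductive form (S : signature) : Type :=
| Bot
| Eq of term S & term S
| Rel (P : rsym S) of {ffun 'I_(rar P) -> term S}
| Imp of form S & form S
| All of form S.
Arguments Bot {S}.
Arguments Eq {S} _ _.
Arguments Rel {S} P _.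
Arguments Imp {S} _ _.
Arguments All {S} _.

Definition args (T : Type) (n : nat) (s : n.-tuple T) : {ffun 'I_n -> T} :=
  [ffun i => tnth s i].

Section Logic.

Variable S : signature.
Implicit Types (t : term S) (p q : form S).

Definition Not p := Imp p Bot.
Definition Top : form S := Not Bot.
Definition Or p q := Imp (Not p) q.
Definition And p q := Not (Imp p (Not q)).
Definition Iff p q := And (Imp p q) (Imp q p).
Definition Ex p := Not (All (Not p)).

Fixpoint tsubst (s : nat -> term S) t : term S :=
  match t with
  | Var i => s i
  | App f a => App f [ffun i => tsubst s (a i)]
  end.

Definition is_var t : bool := if t is Var _ then true else false.

Definition tshift : term S -> term S := tsubst (fun i => Var i.+1).

Definition up (s : nat -> term S) (i : nat) : term S :=
  if i is j.+1 then tshift (s j) else Var 0.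

Fixpoint subst (s : nat -> term S) p : form S :=
  match p with
  | Bot => Bot
  | Eq t u => Eq (tsubst s t) (tsubst s u)
  | Rel P a => Rel P [ffun i => tsubst s (a i)]
  | Imp p q => Imp (subst s p) (subst s q)
  | All p => All (subst (up s) p)
  end.

Definition shift : form S -> form S := subst (fun i => Var i.+1).

Definition inst (t : term S) : form S -> form S :=
  subst (fun i => if i is j.+1 then Var j else t).

(* All free variables have index < n; [sentence] is closedness. *)
Fixpoint tbounded (n : nat) t : bool :=
  match t with
  | Var i => i < n
  | App f a => [forall i, tbounded n (a i)]
  end.

Fixpoint bounded (n : nat) p : bool :=
  match p with
  | Bot => true
  | Eq t u => tbounded n t && tbounded n u
  | Rel P a => [forall i, tbounded n (a i)]
  | Imp p q => bounded n p && bounded n q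
  | All p => bounded n.+1 p
  end.

Definition sentence p : bool := bounded 0 p.

Inductive derives : seq (form S) -> form S -> Prop :=
| D_ax G p : List.In p G -> derives G p
| D_impI G p q : derives (p :: G) q -> derives G (Imp p q)
| D_impE G p q : derives G (Imp p q) -> derives G p -> derives G q
| D_raa G p : derives (Not p :: G) Bot -> derives G p
| D_allI G p : derives (map shift G) p -> derives G (All p)
| D_allE G p t : derives G (All p) -> derives G (inst t p)
| D_refl G t : derives G (Eq t t)
| D_leibniz G t u p :
    derives G (Eq t u) -> derives G (inst t p) -> derives G (inst u p).

Definition theory := form S -> Prop.

Definition proves (T : theory) p : Prop :=
  exists2 G : seq (form S), (forall q, List.In q G -> T q) & derives G p.

End Logic.

Arguments Top {S}.

(* A one-dimensional, parameter-free, relative translation. Identity need not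
   be translated as identity. In [tr_fun f] the variables 0, ..., far f - 1
   are the arguments and the variable far f is the value. *)
Record translation (S T : signature) := Translation {
  tr_dom : form T;
  tr_eq : form T;
  tr_fun : fsym S -> form T;
  tr_rel : rsym S -> form T;
  tr_dom_bounded : bounded 1 tr_dom;
  tr_eq_bounded : bounded 2 tr_eq;
  tr_fun_bounded : forall f, bounded (far f).+1 (tr_fun f);
  tr_rel_bounded : forall P, bounded (rar P) (tr_rel P) }.

Section Translate.

Variables (S T : signature) (tau : translation S T).

Definition dom_at (x : nat) : form T := subst (fun=> Var x) (tr_dom tau).

Definition eq_at (x y : nat) : form T :=
  subst (fun k => if k is 0 then Var x else Var y) (tr_eq tau).

(* Nested terms are unravelled. [graph r t x] translates t = x, where the
   variables of t are renamed by r. For t = f(t_0, ..., t_{n-1}) it says that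
   there are y_0, ..., y_{n-1} in the domain with t_i = y_i and
   f(y_0, ..., y_{n-1}) = x. When t_i is a variable, it is itself put in place
   of y_i, so that the quantifier over y_i becomes vacuous. *)
Definition arg_var (r : nat -> nat) n (a : {ffun 'I_n -> term S}) (k : 'I_n) :=
  if a k is Var j then r j + n else val k.

Fixpoint graph (r : nat -> nat) (t : term S) (x : nat) : form T :=
  match t with
  | Var j => eq_at (r j) x
  | App f a =>
      let n := far f in
      iter n (@Ex T) (And
        (\big[@And T/Top]_(i < n)
           if is_var (a i) then Top
           else And (dom_at i) (graph (fun j => r j + n) (a i) i))
        (subst (fun k => if insub k is Some i then Var (arg_var r a i)
                         else Var (x + n))
               (tr_fun tau f)))
  end.

Definition translate_eq (t u : term S) : form T :=
  match t, u with
  | _, Var j => graph id t j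
  | Var i, App _ _ => graph id u i
  | App _ _, App _ _ =>
      Ex (And (dom_at 0) (And (graph succn t 0) (graph succn u 0)))
  end.

Definition translate_rel (P : rsym S) (a : {ffun 'I_(rar P) -> term S}) :=
  let n := rar P in
  iter n (@Ex T) (And
    (\big[@And T/Top]_(i < n)
       if is_var (a i) then Top
       else And (dom_at i) (graph (fun j => j + n) (a i) i))
    (subst (fun k => if insub k is Some i then Var (arg_var id a i) else Var k)
           (tr_rel tau P))).

Fixpoint translate (p : form S) : form T :=
  match p with
  | Bot => Bot
  | Eq t u => translate_eq t u
  | Rel P a => translate_rel a
  | Imp p q => Imp (translate p) (translate q)
  | All p => All (Imp (dom_at 0) (translate p))
  end.

End Translate.

(* Since identity, nonemptiness of the domain and totality and functionality
   of the function symbols are part of the logic of U, their translations are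
   required to be provable in V as well. *)
Definition interpretation (S T : signature) (tau : translation S T)
    (V : theory T) (U : theory S) : Prop :=
  forall p : form S, sentence p -> proves U p -> proves V (translate tau p).

Definition interprets_1d (S T : signature) (V : theory T) (U : theory S) :=
  exists tau : translation S T, interpretation tau V U.

Inductive set_rsym := MemSym.

Definition set_sig : signature :=
  @Signature void (fun=> 0) set_rsym (fun=> 2).

Definition Mem (t u : term set_sig) : form set_sig :=
  @Rel set_sig MemSym (args [tuple t; u]).

Definition VS_empty : form set_sig := Ex (All (Not (Mem (Var 0) (Var 1)))).

(* Under the quantifiers over x and y, the u_i are the variables i + 2. *)
Definition VS_set (n : nat) : form set_sig :=
  iter n All (Ex (All (Iff (Mem (Var 0) (Var 1))
    (\big[@Or set_sig/Bot]_(i < n) Eq (Var 0) (Var i.+2))))).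

(* Vaught set theory; there is no extensionality axiom. *)
Inductive VS : theory set_sig :=
| VS_ax_empty : VS VS_empty
| VS_ax_set n : VS (VS_set n).

Inductive arith_fsym := ZeroSym | SuccSym | AddSym | MulSym.

Definition arith_far (f : arith_fsym) : nat :=
  match f with ZeroSym => 0 | SuccSym => 1 | AddSym => 2 | MulSym => 2 end.

Definition arith_sig : signature :=
  @Signature arith_fsym arith_far void (fun=> 0).

Definition Zero : term arith_sig :=
  @App arith_sig ZeroSym (args [tuple]).
Definition Succ (t : term arith_sig) : term arith_sig :=
  @App arith_sig SuccSym (args [tuple t]).
Definition Add (t u : term arith_sig) : term arith_sig :=
  @App arith_sig AddSym (args [tuple t; u]).
Definition Mul (t u : term arith_sig) : term arith_sig :=
  @App arith_sig MulSym (args [tuple t; u]).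

Definition numeral (n : nat) : term arith_sig := iter n Succ Zero.

Definition Le (t u : term arith_sig) : form arith_sig :=
  Ex (Eq (Add (Var 0) (tshift t)) (tshift u)).

(* The arithmetic R of Tarski, Mostowski and Robinson, not Robinson's Q. *)
Inductive R : theory arith_sig :=
| R_add m n : R (Eq (Add (numeral m) (numeral n)) (numeral (m + n)))
| R_mul m n : R (Eq (Mul (numeral m) (numeral n)) (numeral (m * n)))
| R_neq m n : m <> n -> R (Not (Eq (numeral m) (numeral n)))
| R_le n : R (All (Imp (Le (Var 0) (numeral n))
                       (\big[@Or arith_sig/Bot]_(k < n.+1)
                          Eq (Var 0) (numeral k))))
| R_total n : R (All (Or (Le (Var 0) (numeral n)) (Le (numeral n) (Var 0)))).

(* Main.v *)
(** By completeness it suffices to treat a model M of VS; as VS has no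
    extensionality, everything is counted on its externally finite sets. A
    number is a singleton {b}, identified with {c} when b and c are equinumerous
    to the same sets; sums and products are those of the cardinality classes,
    whenever such a class exists, and a default value otherwise. On finite sets
    this gives the standard numerals, and all the operations are total and
    functional by construction. The one axiom concerning nonstandard elements,
    [x <= n \/ n <= x], is obtained by letting a pair (s, t) be a formal
    difference: (s, t) + t = s provided that t injects into s. *)

From mathcomp Require Import all_boot boolp.
From Stdlib Require List.
Require Import Defs.

Set Implicit Arguments.
Unset Strict Implicit.
Unset Printing Implicit Defensive.

(** * Substitution and semantics *)


(** [VS] supplies only externally finite sets: over an infinite set it grants no bijection, union or
    product, so [equinum] cannot be shown reflexive, symmetric or transitive in general. Two sets
    are therefore compared through the sets they are equinumerous to, which is an equivalence by
    logic alone. Wrapping a cardinality in a singleton keeps it apart from formal differences: a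
    pair with distinct components is never a singleton, so differences can be added without
    disturbing sums of standard numbers. The default value of an operation is its second argument;
    since [x <= n] reads z + x = n, a defaulted sum equals n only if x already does, so the fallback
    puts no nonstandard element below n. On the logical side, identity is interpreted by a
    congruence and not by equality, so that a derivation from [R] can be evaluated directly on a
    model of [VS] with [num_eq] as identity. *)

Section Syntax.

Variable S : signature.
Implicit Types (t u : term S) (p q : form S) (s : nat -> term S).

(** The arguments of a function symbol are nested inside a finite function, where the generated
    induction principle provides no hypothesis about them. *)
Lemma term_rect_args (P : term S -> Prop) :
  (forall i, P (Var i)) ->
  (forall f (a : {ffun _ -> _}), (forall i, P (a i)) -> P (App f a)) ->
  forall t, P t.
Proof.
move=> PV PA; fix IH 1 => t; case: t => [i|f a]; first exact: PV.
by apply: PA => i; apply: IH.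
Qed.

Lemma eq_tsubst s s' : s =1 s' -> tsubst s =1 tsubst s'.
Proof.
move=> ss; elim/term_rect_args=> [i|f a IH] /=; first exact: ss.
by congr App; apply/ffunP=> i; rewrite !ffunE.
Qed.

Lemma tsubst_id t : tsubst Var t = t.
Proof.
elim/term_rect_args: t => //= f a IH.
by congr App; apply/ffunP=> i; rewrite !ffunE.
Qed.

Lemma tsubst_comp s s' t :
  tsubst s' (tsubst s t) = tsubst (fun i => tsubst s' (s i)) t.
Proof.
elim/term_rect_args: t => //= f a IH.
by congr App; apply/ffunP=> i; rewrite !ffunE.
Qed.

Lemma eq_tsubst_bounded n s s' t : tbounded n t ->
  (forall i, i < n -> s i = s' i) -> tsubst s t = tsubst s' t.
Proof.
move=> + ss; elim/term_rect_args: t => [i|f a IH] /=; first exact: ss.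
by move=> /forallP b; congr App; apply/ffunP=> i; rewrite !ffunE IH.
Qed.

Lemma up_var : up (@Var S) = Var.
Proof. by apply: funext => -[]. Qed.

Lemma up_comp s s' i :
  up (fun i => tsubst s' (s i)) i = tsubst (up s') (up s i).
Proof. by case: i => //= i; rewrite /tshift !tsubst_comp. Qed.

Lemma subst_id p : subst Var p = p.
Proof.
elim: p => //= [t u|P a|p -> q ->|p IH] //.
- by rewrite !tsubst_id.
- by congr Rel; apply/ffunP=> i; rewrite ffunE tsubst_id.
- by rewrite up_var IH.
Qed.

Lemma subst_comp s s' p :
  subst s' (subst s p) = subst (fun i => tsubst s' (s i)) p.
Proof.
elim: p s s' => //= [t u|P a|p IHp q IHq|p IH] s s'.
- by rewrite !tsubst_comp.
- by congr Rel; apply/ffunP=> i; rewrite !ffunE tsubst_comp.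
- by rewrite IHp IHq.
- by rewrite IH; congr (All (subst _ p)); apply: funext => i; rewrite up_comp.
Qed.

Lemma eq_subst_bounded n s s' p : bounded n p ->
  (forall i, i < n -> s i = s' i) -> subst s p = subst s' p.
Proof.
elim: p n s s' => //= [t u|P a|p IHp q IHq|p IH] n s s'.
- by move=> /andP[bt bu] ss; rewrite !(eq_tsubst_bounded _ ss).
- move=> /forallP b ss; congr Rel; apply/ffunP=> i.
  by rewrite !ffunE (eq_tsubst_bounded _ ss).
- by move=> /andP[bp bq] ss; rewrite (IHp _ _ _ bp ss) (IHq _ _ _ bq ss).
- move=> b ss; congr All; apply: IH b _ => -[|i] //= i_n.
  by rewrite ss.
Qed.

Lemma leq_tbounded m n t : m <= n -> tbounded m t -> tbounded n t.
Proof.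
move=> mn; elim/term_rect_args: t => [i|f a IH] /=; first by move/leq_trans; apply.
by move=> /forallP b; apply/forallP=> i; apply: IH.
Qed.

Lemma leq_bounded m n p : m <= n -> bounded m p -> bounded n p.
Proof.
elim: p m n => //= [t u|P a|p IHp q IHq|p IH] m n mn.
- by move=> /andP[]; do 2![move/(leq_tbounded mn) => ->].
- by move=> /forallP b; apply/forallP=> i; apply: leq_tbounded mn _.
- by move=> /andP[/(IHp _ _ mn)-> /(IHq _ _ mn)->].
- exact: IH.
Qed.

Lemma args_bounded n (a : {ffun 'I_n -> term S}) :
  (forall i, exists m, tbounded m (a i)) ->
  exists m, [forall i, tbounded m (a i)].
Proof.
move=> /choice[m b]; exists (\max_i m i); apply/forallP=> i.
exact: leq_tbounded (leq_bigmax i) _.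
Qed.

Lemma tbounded_ex t : exists n, tbounded n t.
Proof.
elim/term_rect_args: t => [i|f a IH]; first by exists i.+1 => /=.
exact: args_bounded.
Qed.

Lemma bounded_ex p : exists n, bounded n p.
Proof.
elim: p => [|t u|P a|p [m bp] q [n bq]|p [n bp]].
- by exists 0.
- have [[m bt] [n bu]] := (tbounded_ex t, tbounded_ex u).
  exists (maxn m n) => /=.
  by rewrite (leq_tbounded _ bt) ?(leq_tbounded _ bu) ?leq_maxl ?leq_maxr.
- exact: args_bounded (fun i => tbounded_ex (a i)).
- exists (maxn m n) => /=.
  by rewrite (leq_bounded _ bp) ?(leq_bounded _ bq) ?leq_maxl ?leq_maxr.
- by exists n; apply: leq_bounded bp.
Qed.

Definition scons (T : Type) (x : T) (r : nat -> T) (i : nat) : T :=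
  if i is j.+1 then r j else x.

Lemma inst_up t s p : inst t (subst (up s) p) = subst (scons t s) p.
Proof.
rewrite /inst subst_comp; congr (subst _ p); apply: funext => -[|i] //=.
by rewrite /tshift tsubst_comp /= tsubst_id.
Qed.

Lemma subst_inst s t p :
  subst s (inst t p) = inst (tsubst s t) (subst (up s) p).
Proof.
rewrite inst_up /inst subst_comp; congr (subst _ p).
by apply: funext => -[].
Qed.

Lemma subst_shift s p : subst (up s) (shift p) = shift (subst s p).
Proof. by rewrite /shift !subst_comp. Qed.

Lemma derives_weak (G H : seq (form S)) p :
  derives G p -> List.incl G H -> derives H p.
Proof.
move=> d; elim: d H => {G p} [G p Gp|G p q _ IH|G p q _ IH1 _ IH2|G p _ IH
  |G p _ IH|G p t _ IH|G t|G t u p _ IH1 _ IH2] H GH.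
- exact/D_ax/GH.
- by apply/D_impI/IH => x [->|/GH]; [left|right].
- by apply: D_impE (IH1 _ GH) (IH2 _ GH).
- by apply/D_raa/IH => x [->|/GH]; [left|right].
- by apply/D_allI/IH/List.incl_map.
- exact/D_allE/IH.
- exact: D_refl.
- exact: D_leibniz (IH1 _ GH) (IH2 _ GH).
Qed.

Lemma derives_subst (G : seq (form S)) p s :
  derives G p -> derives (map (subst s) G) (subst s p).
Proof.
move=> d; elim: d s => {G p} [G p Gp|G p q _ IH|G p q _ IH1 _ IH2|G p _ IH
  |G p _ IH|G p t _ IH|G t|G t u p _ IH1 _ IH2] s /=.
- exact/D_ax/List.in_map.
- exact: D_impI (IH s).
- exact: D_impE (IH1 s) (IH2 s).
- exact: D_raa (IH s).
- apply: D_allI; have := IH (up s); rewrite -!map_comp.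
  by congr (derives _ _); apply: eq_map => q /=; rewrite subst_shift.
- by rewrite subst_inst; apply/D_allE/IH.
- exact: D_refl.
- rewrite subst_inst; apply: D_leibniz (IH1 s) _.
  by rewrite -subst_inst; apply: IH2.
Qed.

(** The renaming sends k to 0 and every other i to i + 1. On formulas with variables below k it is
    the shift demanded by [D_allI], and on [inst (Var k) p] it undoes the instantiation. *)
Lemma derives_gen (G : seq (form S)) p k :
  (forall q, List.In q G -> bounded k q) -> bounded k.+1 p ->
  derives G (inst (Var k) p) -> derives G (All p).
Proof.
move=> bG bp /(derives_subst (fun i => if i == k then Var 0 else Var i.+1)) d.
apply: D_allI; move: d; congr (derives _ _).
- apply: List.map_ext_in => q /bG b; apply: eq_subst_bounded b _ => i i_k.
  by rewrite ltn_eqF.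
- rewrite /inst subst_comp -[RHS]subst_id; apply: eq_subst_bounded bp _.
  by case=> [|i] /= i_k; rewrite ?eqxx // ltn_eqF.
Qed.

Lemma derives_exfalso (G : seq (form S)) p : derives G Bot -> derives G p.
Proof. by move=> d; apply: D_raa; apply: derives_weak d _; right. Qed.

End Syntax.

(** Identity is read as an arbitrary relation [seqv], so that terms under provable equality and
    elements of a model under [num_eq] form structures as they stand. *)
Record structure (S : signature) := Structure {
  carrier :> Type;
  sfun : forall f : fsym S, ('I_(far f) -> carrier) -> carrier;
  srel : forall P : rsym S, ('I_(rar P) -> carrier) -> Prop;
  seqv : carrier -> carrier -> Prop }.
Arguments sfun {S} _ _ _.
Arguments srel {S} _ _ _.
Arguments seqv {S} _ _ _.

Record congruence (S : signature) (A : structure S) : Prop := Congruence {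
  seqv_refl : forall x, seqv A x x;
  seqv_sym : forall x y, seqv A x y -> seqv A y x;
  seqv_trans : forall x y z, seqv A x y -> seqv A y z -> seqv A x z;
  sfun_congr : forall f a b, (forall i, seqv A (a i) (b i)) ->
    seqv A (sfun A f a) (sfun A f b);
  srel_congr : forall P a b, (forall i, seqv A (a i) (b i)) ->
    srel A P a -> srel A P b }.

Section Semantics.

Variables (S : signature) (A : structure S).
Implicit Types (t u : term S) (p q : form S) (rho : nat -> A).

Fixpoint eval rho t : A :=
  match t with
  | Var i => rho i
  | App f a => sfun A f (fun i => eval rho (a i))
  end.

Fixpoint sat rho p : Prop :=
  match p with
  | Bot => False
  | Eq t u => seqv A (eval rho t) (eval rho u)
  | Rel P a => srel A P (fun i => eval rho (a i))
  | Imp p q => sat rho p -> sat rho q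
  | All p => forall x, sat (scons x rho) p
  end.

Lemma sat_And rho p q P Q : (sat rho p <-> P) -> (sat rho q <-> Q) ->
  sat rho (And p q) <-> P /\ Q.
Proof.
move=> [p1 p2] [q1 q2] /=; split=> [h|[/p2 hp /q2 hq] h]; last exact: h.
by split; apply: contrapT => n; apply: h => hp hq; apply: n; [apply: p1|apply: q1].
Qed.

Lemma sat_Or rho p q P Q : (sat rho p <-> P) -> (sat rho q <-> Q) ->
  sat rho (Or p q) <-> P \/ Q.
Proof.
move=> [p1 p2] [q1 q2] /=; split=> [h|[/p2 //|/q2 //]].
by have [/p1|np] := EM (sat rho p); [left|right; apply/q1/h].
Qed.

Lemma sat_Iff rho p q P Q : (sat rho p <-> P) -> (sat rho q <-> Q) ->
  sat rho (Iff p q) <-> (P <-> Q).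
Proof. by move=> hp hq; apply: sat_And => /=; rewrite hp hq. Qed.

Lemma sat_Ex rho p (P : A -> Prop) :
  (forall x, sat (scons x rho) p <-> P x) ->
  sat rho (Ex p) <-> exists x, P x.
Proof.
move=> pP /=; split=> [h|[x /pP px] h]; last exact: h px.
by apply: contrapT => n; apply: h => x /pP px; apply: n; exists x.
Qed.

Lemma sat_All rho p (P : A -> Prop) :
  (forall x, sat (scons x rho) p <-> P x) ->
  sat rho (All p) <-> forall x, P x.
Proof. by move=> pP; split=> h x; apply/pP. Qed.

Lemma sat_Imp rho p q P Q : (sat rho p <-> P) -> (sat rho q <-> Q) ->
  sat rho (Imp p q) <-> (P -> Q).
Proof. by move=> /= -> ->. Qed.

Lemma sat_Not rho p P : (sat rho p <-> P) -> sat rho (Not p) <-> ~ P.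
Proof. by move=> /= ->. Qed.

Lemma sat_bigOr rho n (F : 'I_n -> form S) :
  sat rho (\big[@Or S/Bot]_(i < n) F i) <-> exists i, sat rho (F i).
Proof.
elim: n F => [|n IH] F; first by rewrite big_ord0; split=> // -[[]].
rewrite big_ord_recl; apply: (iff_trans (sat_Or (iff_refl _) (IH _))).
split=> [[h|[i h]]|[i]]; [by exists ord0|by exists (lift ord0 i)|].
by case: (unliftP ord0 i) => [j ->|->] h; [right; exists j|left].
Qed.

Lemma sat_bigAnd rho n (F : 'I_n -> form S) :
  sat rho (\big[@And S/Top]_(i < n) F i) <-> forall i, sat rho (F i).
Proof.
elim: n F => [|n IH] F; first by rewrite big_ord0; split=> // _ [].
rewrite big_ord_recl; apply: (iff_trans (sat_And (iff_refl _) (IH _))).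
split=> [[h0 h] i|h]; last by split.
by case: (unliftP ord0 i) => [j ->|->].
Qed.

Definition block n (v rho : nat -> A) (k : nat) : A :=
  if k < n then v k else rho (k - n).

Lemma block_addn n v rho k : block n v rho (k + n) = rho k.
Proof. by rewrite /block ltnNge leq_addl addnK. Qed.

Lemma block_scons n v rho :
  block n v (scons (v n) rho) = block n.+1 v rho.
Proof.
apply: funext => k; rewrite /block ltnS; case: (ltngtP k n) => [//|h|->].
- by rewrite -(subnSK h).
- by rewrite subnn.
Qed.

Lemma sat_iter_All n rho p :
  sat rho (iter n (@All S) p) <-> forall v, sat (block n v rho) p.
Proof.
elim: n rho => [|n IH] rho /=.
  have e v : block 0 v rho = rho by apply: funext => k; rewrite /block subn0.
  by split=> [h v|/(_ rho)]; rewrite e.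
split=> [h v|h x]; first by rewrite -block_scons; apply: (iffLR (IH _) (h (v n))).
(* Position n belongs to the outermost quantifier, so [v] is cut off below n and continued by x. *)
apply/IH => v; have := h (fun k => if k < n then v k else x).
rewrite -block_scons ltnn; congr sat; apply: funext => k.
by rewrite /block; case: (k < n).
Qed.

Lemma sat_iter_Ex n rho p :
  sat rho (iter n (@Ex S) p) <-> exists v, sat (block n v rho) p.
Proof.
elim: n rho => [|n IH] rho.
  have e v : block 0 v rho = rho by apply: funext => k; rewrite /block subn0.
  by split=> [h|[v]]; [exists rho|]; rewrite e.
apply: (iff_trans (sat_Ex (fun x => IH (scons x rho)))); split=> [[x [v h]]|[v h]].
  exists (fun k => if k < n then v k else x).
  rewrite -block_scons ltnn; move: h; congr sat; apply: funext => k.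
  by rewrite /block; case: (k < n).
by exists (v n), v; rewrite block_scons.
Qed.

Lemma eval_tsubst rho s t :
  eval rho (tsubst s t) = eval (fun i => eval rho (s i)) t.
Proof.
elim/term_rect_args: t => //= f a IH.
by congr sfun; apply: funext => i; rewrite ffunE IH.
Qed.

Lemma eval_tshift x rho t : eval (scons x rho) (tshift t) = eval rho t.
Proof. by rewrite eval_tsubst. Qed.

Lemma eval_up x rho s :
  (fun i => eval (scons x rho) (up s i)) = scons x (fun i => eval rho (s i)).
Proof. by apply: funext => -[|i] //=; rewrite eval_tshift. Qed.

Lemma sat_subst rho s p :
  sat rho (subst s p) <-> sat (fun i => eval rho (s i)) p.
Proof.
elim: p rho s => //= [t u|P a|p IHp q IHq|p IH] rho s.
- by rewrite !eval_tsubst.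
- by under [X in srel A P X]funext => i do rewrite ffunE eval_tsubst.
- by rewrite IHp IHq.
- by split=> h x; have := h x; rewrite IH eval_up.
Qed.

Lemma sat_inst rho t p :
  sat rho (inst t p) <-> sat (scons (eval rho t) rho) p.
Proof.
have e : scons (eval rho t) rho =
    (fun i => eval rho (if i is j.+1 then Var j else t)).
  by apply: funext => -[].
by rewrite e sat_subst.
Qed.

Lemma sat_shift x rho p : sat (scons x rho) (shift p) <-> sat rho p.
Proof. by rewrite sat_subst. Qed.

Hypothesis cA : congruence A.

Lemma eval_congr rho rho' t : (forall i, seqv A (rho i) (rho' i)) ->
  seqv A (eval rho t) (eval rho' t).
Proof.
by move=> rr; elim/term_rect_args: t => //= f a IH; apply: sfun_congr.
Qed.

Lemma sat_congr rho rho' p : (forall i, seqv A (rho i) (rho' i)) ->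
  sat rho p <-> sat rho' p.
Proof.
have sym := seqv_sym cA; have tr := seqv_trans cA.
elim: p rho rho' => //= [t u|P a|p IHp q IHq|p IH] rho rho' rr.
- have [et eu] := (eval_congr t rr, eval_congr u rr).
  split=> h; first exact: tr (sym _ _ et) (tr _ _ _ h eu).
  exact: tr et (tr _ _ _ h (sym _ _ eu)).
- by split; apply: srel_congr => // i; [|apply: sym]; apply: eval_congr.
- by rewrite (IHp _ _ rr) (IHq _ _ rr).
- have rx x i : seqv A (scons x rho i) (scons x rho' i).
    by case: i => //=; apply: seqv_refl.
  by split=> h x; apply/(IH _ _ (rx x)).
Qed.

Lemma soundness (G : seq (form S)) p : derives G p ->
  forall rho, (forall q, List.In q G -> sat rho q) -> sat rho p.
Proof.
elim=> {G p} [G p Gp|G p q _ IH|G p q _ IH1 _ IH2|G p _ IH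
  |G p _ IH|G p t _ IH|G t|G t u p _ IH1 _ IH2] rho h /=.
- exact: h.
- by move=> hp; apply: IH => r [<-|/h].
- exact: (IH1 _ h) (IH2 _ h).
- by apply: contrapT => np; apply: (IH rho) => r [<-|/h].
- move=> x; apply: IH => r /List.in_map_iff[r' [<- /h]].
  by rewrite sat_shift.
- by rewrite sat_inst; apply: IH.
- exact: seqv_refl.
- have := IH2 _ h; rewrite !sat_inst; apply: (iffLR (sat_congr _ _)) => -[|i] /=.
    exact: IH1 h.
  exact: seqv_refl.
Qed.

End Semantics.

(** * Passing to a structure with genuine equality *)

Section Quotient.

Variables (S : signature) (A : structure S).
Hypothesis cA : congruence A.

Definition eqclass := {c : A -> Prop | exists x, c = seqv A x}.

Definition class_of (x : A) : eqclass :=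
  exist _ (seqv A x) (ex_intro _ x erefl).

Definition class_rep (c : eqclass) : A := projT1 (cid (proj2_sig c)).

Lemma class_repK : cancel class_rep class_of.
Proof.
case=> c ex; apply: eq_exist => /=.
by rewrite /class_rep; case: cid.
Qed.

Lemma class_of_rep x : seqv A (class_rep (class_of x)) x.
Proof.
rewrite /class_rep; case: cid => y /= e; rewrite -e.
exact: seqv_refl.
Qed.

Lemma eq_class_of x y : class_of x = class_of y <-> seqv A x y.
Proof.
split=> [[e]|xy]; first by rewrite e; apply: seqv_refl.
apply: eq_exist; apply: funext => z; apply: propext.
by split=> h; [apply: seqv_trans h|apply: seqv_trans h] => //; apply: seqv_sym.
Qed.

Definition quotient : structure S := @Structure S eqclass
  (fun f a => class_of (sfun A f (fun i => class_rep (a i))))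
  (fun P a => srel A P (fun i => class_rep (a i))) eq.

Lemma eval_quotient (rho : nat -> quotient) t :
  eval rho t = class_of (eval (fun i => class_rep (rho i)) t).
Proof.
elim/term_rect_args: t => /= [i|f a IH]; first by rewrite class_repK.
apply/eq_class_of/sfun_congr => // i; rewrite IH; exact: class_of_rep.
Qed.

Lemma sat_quotient (rho : nat -> quotient) p :
  sat rho p <-> sat (fun i => class_rep (rho i)) p.
Proof.
elim: p rho => //= [t u|P a|p IHp q IHq|p IH] rho.
- by rewrite !eval_quotient eq_class_of.
- have e i : seqv A (class_rep (@eval S quotient rho (a i)))
      (eval (fun i => class_rep (rho i)) (a i)).
    by rewrite eval_quotient; apply: class_of_rep.
  split; apply: srel_congr => // i; exact: seqv_sym.
- by rewrite IHp IHq.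
- split=> h x; last first.
    apply/IH; apply: (iffLR (sat_congr cA _ _) (h (class_rep x))).
    by case=> [|i]; apply: seqv_refl.
  have := iffLR (IH _) (h (class_of x)).
  apply: (iffLR (sat_congr cA _ _)) => -[|i] /=; first exact: class_of_rep.
  exact: seqv_refl.
Qed.

End Quotient.

(** * Completeness *)


Section Henkin.

Variables (S : signature) (T : theory S) (e : nat -> form S).
Hypothesis T_sentence : forall q, T q -> sentence q.
Hypothesis e_onto : forall p, exists n, e n = p.
Implicit Types (t u : term S) (p q : form S) (G H : seq (form S)).

(** The finite context G is kept apart from the axioms drawn from T, because only G constrains the
    choice of a fresh variable: the axioms are sentences. *)
Definition proves_from G p : Prop :=
  exists2 H, (forall q, List.In q H -> T q) & derives (H ++ G) p.

Lemma proves_from_weak G G' p :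
  List.incl G G' -> proves_from G p -> proves_from G' p.
Proof.
move=> GG' [H TH d]; exists H => //.
apply: derives_weak d _; apply: List.incl_app; first exact: List.incl_appl.
exact: List.incl_appr.
Qed.

Lemma proves_from_derives G L p :
  (forall q, List.In q L -> proves_from G q) -> derives L p -> proves_from G p.
Proof.
elim: L p => [|q L IH] p GL d.
  by exists [::] => //; apply: derives_weak d _ => x [].
have [|H1 TH1 d1] := IH (Imp q p) _ (D_impI d).
  by move=> r Lr; apply: GL; right.
have [H2 TH2 d2] := GL q (or_introl erefl).
exists (H1 ++ H2); first by move=> r /List.in_app_iff[/TH1|/TH2].
apply: (@D_impE _ _ q).
- apply: derives_weak d1 _ => x /List.in_app_iff[xH|xG];
    rewrite !List.in_app_iff; tauto.
- apply: derives_weak d2 _ => x /List.in_app_iff[xH|xG];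
    rewrite !List.in_app_iff; tauto.
Qed.

Lemma proves_from_raa G p : proves_from (Not p :: G) Bot -> proves_from G p.
Proof.
move=> [H TH d]; exists H => //; apply: D_raa; apply: derives_weak d _.
by move=> x; rewrite /= !List.in_app_iff /=; tauto.
Qed.

Definition consistent G := ~ proves_from G Bot.

Definition seq_bound G k := forall q, List.In q G -> bounded k q.

Lemma seq_bound_ex G : exists k, seq_bound G k.
Proof.
elim: G => [|p G [k bk]]; first by exists 0.
have [m bm] := bounded_ex p.
exists (maxn m k) => q [<-|/bk b]; [apply: leq_bounded bm|apply: leq_bounded b].
- exact: leq_maxl.
- exact: leq_maxr.
Qed.

Definition fresh G : nat := projT1 (cid (seq_bound_ex G)).

Lemma freshP G : seq_bound G (fresh G).
Proof. by rewrite /fresh; case: cid. Qed.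

(** Existence is a negated universal, so this is the one shape that calls for a Henkin witness. A
    variable fresh for the finite stage takes the place of a new constant, and the signature stays
    the same. *)
Definition witness G p : seq (form S) :=
  if p is Imp (All q) Bot then [:: Not (inst (Var (fresh (p :: G))) q)]
  else [::].

(** If the witness made the context inconsistent, the context would prove the instance of q at a
    fresh variable, hence [All q] by generalization, against p. *)
Lemma witness_consistent G p :
  consistent (p :: G) -> consistent (witness G p ++ p :: G).
Proof.
case: p => // -[] // q [] // con /proves_from_raa[H TH d]; apply: con.
apply: (@proves_from_derives _ [:: Not (All q); All q]); last first.
  by apply: (@D_impE _ _ (All q)); apply: D_ax; [left|right; left].
move=> r [<-|[<-|[]]].
  by exists [::] => //; apply: D_ax; left.
exists H => //; apply: derives_gen d.
- move=> r' /List.in_app_iff[/TH/T_sentence/leq_bounded|]; first exact.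
  exact: freshP.
- by have := freshP (or_introl erefl : List.In _ (Not (All q) :: G)); move=> /andP[].
Qed.

Variable p0 : form S.
Hypothesis p0_consistent : consistent [:: p0].

Fixpoint stage n : seq (form S) :=
  if n is m.+1 then
    if `[< consistent (e m :: stage m) >]
    then witness (stage m) (e m) ++ e m :: stage m else stage m
  else [:: p0].

Lemma stage_consistent n : consistent (stage n).
Proof.
elim: n => //= n IH; case: asboolP => // ?; exact: witness_consistent.
Qed.

Lemma stage_incl m n : m <= n -> List.incl (stage m) (stage n).
Proof.
elim: n => [|n IH]; first by rewrite leqn0 => /eqP ->; apply: List.incl_refl.
rewrite leq_eqVlt => /orP[/eqP->|]; first exact: List.incl_refl.
move=> /IH mn /=; case: asboolP => // _; apply: List.incl_tran mn _.
by apply: List.incl_appr; right.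
Qed.

Definition limit p : Prop := exists n, proves_from (stage n) p.

Lemma limit_derives L p :
  (forall q, List.In q L -> limit q) -> derives L p -> limit p.
Proof.
move=> hL d; suff [n hn] : exists n, forall q, List.In q L -> proves_from (stage n) q.
  by exists n; apply: proves_from_derives hn d.
elim: L hL {d} => [|q L IH] hL; first by exists 0.
have [|m hm] := IH; first by move=> r Lr; apply: hL; right.
have [n hn] := hL q (or_introl erefl).
exists (maxn m n) => r [<-|/hm].
- exact: proves_from_weak (stage_incl (leq_maxr m n)) hn.
- exact: proves_from_weak (stage_incl (leq_maxl m n)).
Qed.

Lemma limit_derives1 q p : limit q -> derives [:: q] p -> limit p.
Proof. by move=> hq; apply: limit_derives => r [<-|[]]. Qed.

Lemma limit_derives0 p : derives [::] p -> limit p.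
Proof. exact: limit_derives. Qed.

Lemma limit_theory p : T p -> limit p.
Proof.
move=> Tp; exists 0, [:: p]; first by move=> q [<-|[]].
by apply: D_ax; left.
Qed.

Lemma limit_start : limit p0.
Proof. by exists 0, [::] => //; apply: D_ax; left. Qed.

Lemma limit_Bot : ~ limit Bot.
Proof. by move=> [n]; apply: stage_consistent. Qed.

Lemma limit_ImpE p q : limit (Imp p q) -> limit p -> limit q.
Proof.
move=> hpq hp; apply: (@limit_derives [:: Imp p q; p]) => [r|].
  by move=> [<-|[<-|[]]].
by apply: (@D_impE _ _ p); apply: D_ax; [left|right; left].
Qed.

Lemma limit_complete p : limit p \/ limit (Not p).
Proof.
have [n en] := e_onto p.
have [c|/contrapT c] := EM (consistent (e n :: stage n)).
  left; rewrite -en; exists n.+1, [::] => //=; apply: D_ax.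
  by case: asboolP => // _; apply/List.in_app_iff; right; left.
right; exists n; move: c => [H TH d]; exists H => //; rewrite -en.
apply: D_impI; apply: derives_weak d _ => x.
by rewrite /= !List.in_app_iff /=; tauto.
Qed.

Lemma limit_witness q :
  limit (Not (All q)) -> exists t, limit (Not (inst t q)).
Proof.
move=> nq; have [n en] := e_onto (Not (All q)).
exists (Var (fresh (Not (All q) :: stage n))), n.+1, [::] => //=; apply: D_ax.
case: asboolP => [_|]; first by rewrite en; left.
(* No witness was added only if the formula contradicts its stage; but it belongs to the limit,
   which would then contain falsum. *)
move=> /contrapT[H TH d]; case: limit_Bot; move: d; rewrite en => d.
apply: (@limit_derives (Not (All q) :: H ++ stage n)).
  move=> r [<- //|/List.in_app_iff[/TH/limit_theory //|rn]].
  by exists n, [::] => //; apply: D_ax.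
by apply: derives_weak d _ => x; rewrite /= !List.in_app_iff /=; tauto.
Qed.

Lemma limit_Imp p q : limit (Imp p q) <-> (limit p -> limit q).
Proof.
split=> [|h]; first exact: limit_ImpE.
have [/h hq|np] := limit_complete p.
  by apply: limit_derives1 hq _; apply/D_impI/D_ax; right; left.
apply: limit_derives1 np _; apply/D_impI/derives_exfalso.
by apply: (@D_impE _ _ p); apply: D_ax; [right; left|left].
Qed.

Lemma limit_All q : limit (All q) <-> forall t, limit (inst t q).
Proof.
split=> [h t|h].
  by apply: limit_derives1 h _; apply/D_allE/D_ax; left.
have [//|/limit_witness[t nt]] := limit_complete (All q).
by case: limit_Bot; apply: limit_ImpE nt (h t).
Qed.

Lemma limit_leibniz t u p :
  limit (Eq t u) -> limit (inst t p) -> limit (inst u p).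
Proof.
move=> tu hp; apply: (@limit_derives [:: Eq t u; inst t p]).
  by move=> r [<-|[<-|[]]].
by apply: (@D_leibniz _ _ t); apply: D_ax; [left|right; left].
Qed.

(** Leibniz's law replaces one term at a time. As p has finitely many free variables, finitely many
    replacements lead from s to s'. *)
Lemma limit_subst_eq s s' p : (forall i, limit (Eq (s i) (s' i))) ->
  limit (subst s p) -> limit (subst s' p).
Proof.
move=> ss' hp; have [n bp] := bounded_ex p.
pose mix m i := if i < m then s' i else s i.
suff /(_ n): forall m, limit (subst (mix m) p).
  by congr limit; apply: eq_subst_bounded bp _ => i; rewrite /mix => ->.
elim=> [|m IH].
  by move: hp; congr limit; apply: eq_subst_bounded bp _.
(* Variable 0 is reserved for the places of variable m, so that a single use of [limit_leibniz]
   exchanges [s m] for [s' m]. *)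
pose p' := subst (fun i => if i == m then Var 0 else tshift (mix m i)) p.
have p'E t : inst t p' = subst (fun i => if i == m then t else mix m i) p.
  rewrite /inst /p' subst_comp; apply: eq_subst_bounded bp _ => i _.
  by case: eqP => //= _; rewrite /tshift tsubst_comp /= tsubst_id.
have -> : subst (mix m.+1) p = inst (s' m) p'.
  rewrite p'E; apply: eq_subst_bounded bp _ => i _; rewrite /mix ltnS.
  by case: (ltngtP i m) => // ->.
apply: limit_leibniz (ss' m) _; rewrite p'E; move: IH; congr limit.
apply: eq_subst_bounded bp _ => i _; case: eqP => // ->.
by rewrite /mix ltnn.
Qed.

Definition extend n (a : {ffun 'I_n -> term S}) (k : nat) : term S :=
  if insub k is Some i then a i else Var (k - n).

Lemma extend_ord n (a : {ffun 'I_n -> term S}) (i : 'I_n) : extend a i = a i.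
Proof. by rewrite /extend valK. Qed.

Lemma extend_shift n (a : {ffun 'I_n -> term S}) t :
  tsubst (extend a) (tsubst (fun i => Var (i + n)) t) = t.
Proof.
rewrite tsubst_comp -[RHS]tsubst_id; apply: eq_tsubst => i /=.
by rewrite /extend insubN ?addnK // -leqNgt leq_addl.
Qed.

Lemma limit_eq_refl t : limit (Eq t t).
Proof. exact/limit_derives0/D_refl. Qed.

Lemma limit_args_eq n (a b : {ffun 'I_n -> term S}) p :
  (forall i, limit (Eq (a i) (b i))) ->
  limit (subst (extend a) p) -> limit (subst (extend b) p).
Proof.
move=> ab; apply: limit_subst_eq => i; rewrite /extend.
by case: insubP => // _; apply: limit_eq_refl.
Qed.

Lemma limit_eq_sym t u : limit (Eq t u) -> limit (Eq u t).
Proof.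
move=> tu; pose p := Eq (Var 0) (tshift t).
have pE v : inst v p = Eq v t.
  by rewrite /inst /= /tshift tsubst_comp /= tsubst_id.
by rewrite -pE; apply: limit_leibniz tu _; rewrite pE; apply: limit_eq_refl.
Qed.

Lemma limit_eq_trans t u v : limit (Eq t u) -> limit (Eq u v) -> limit (Eq t v).
Proof.
move=> tu uv; pose p := Eq (tshift t) (Var 0).
have pE w : inst w p = Eq t w.
  by rewrite /inst /= /tshift tsubst_comp /= tsubst_id.
by rewrite -pE; apply: limit_leibniz uv _; rewrite pE.
Qed.

Definition term_model : structure S := @Structure S (term S)
  (fun f a => App f [ffun i => a i])
  (fun P a => limit (Rel P [ffun i => a i])) (fun t u => limit (Eq t u)).

Lemma term_model_congruence : congruence term_model.
Proof.
split=> /=; [exact: limit_eq_refl|exact: limit_eq_sym|exact: limit_eq_trans|..].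
- move=> f a b ab.
  (* The left side is shifted out of reach, so the first [far f] variables are exactly the argument
     places on the right: filled with a they give a reflexivity, filled with b the goal. *)
  pose p := Eq (tsubst (fun i => Var (i + far f)) (App f [ffun i => a i]))
    (App f [ffun i : 'I_(far f) => Var i]).
  have pE (c : {ffun 'I_(far f) -> term S}) :
      subst (extend c) p = Eq (App f [ffun i => a i]) (App f c).
    rewrite /p /subst -/subst extend_shift /=; congr (Eq _ (App f _)).
    by apply/ffunP=> i; rewrite !ffunE /= extend_ord.
  rewrite -pE; apply: (@limit_args_eq _ [ffun i => a i]).
    by move=> i; rewrite !ffunE.
  by rewrite pE; apply: limit_eq_refl.
- move=> P a b ab; pose p := Rel P [ffun i : 'I_(rar P) => Var i].
  have pE (c : {ffun 'I_(rar P) -> term S}) : subst (extend c) p = Rel P c.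
    by congr Rel; apply/ffunP=> i; rewrite !ffunE /= extend_ord.
  rewrite -!pE; apply: limit_args_eq.
  by move=> i; rewrite !ffunE.
Qed.

Lemma sat_term_model (rho : nat -> term_model) p :
  sat rho p <-> limit (subst rho p).
Proof.
elim: p rho => //= [|p IHp q IHq|p IH] rho.
- by split=> // /limit_Bot.
- by rewrite limit_Imp IHp IHq.
- by rewrite limit_All; split=> h t; have := h t; rewrite IH inst_up.
Qed.

End Henkin.

Theorem completeness (S : signature) (T : theory S) (e : nat -> form S) p :
  (forall q, T q -> sentence q) -> (forall q, exists n, e n = q) ->
  (forall A : structure S, (forall x y, seqv A x y <-> x = y) ->
    (forall rho q, T q -> sat (A := A) rho q) ->
    forall rho, sat (A := A) rho p) ->
  proves T p.
Proof.
move=> T_sentence e_onto valid; apply: contrapT => np.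
have con : consistent T [:: Not p].
  move=> [H TH d]; apply: np; exists H => //; apply: D_raa.
  by apply: derives_weak d _ => x; rewrite List.in_app_iff /=; tauto.
have cA := term_model_congruence T e (Not p).
(* Each variable denotes its own class, so truth under [rho] is membership in the limit, for open
   formulas too. *)
pose rho : nat -> quotient (term_model T e (Not p)) :=
  fun i => class_of (Var i : term_model T e (Not p)).
have rhoE q : sat rho q <-> limit T e (Not p) q.
  rewrite (sat_quotient cA) (sat_congr cA (rho' := Var)); last first.
    by move=> i; apply: class_of_rep.
  by rewrite (sat_term_model T_sentence e_onto con) subst_id.
have hp : limit T e (Not p) p.
  apply/rhoE/valid => // rho' q Tq.
  rewrite (sat_quotient cA) (sat_term_model T_sentence e_onto con).
  rewrite (@eq_subst_bounded _ 0 _ Var) ?subst_id //.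
    exact: limit_theory.
  exact: T_sentence.
case: (@limit_Bot _ _ e T_sentence _ con).
exact: limit_ImpE (limit_start T e (Not p)) hp.
Qed.

(** * Semantics of translations *)


Section TranslationSemantics.

Variables (S T : signature) (tau : translation S T) (M : structure T).
Variables (nfun : forall f : fsym S, ('I_(far f) -> M) -> M).
Variables (nrel : forall P : rsym S, ('I_(rar P) -> M) -> Prop).
Variables (neqv : M -> M -> Prop).

Definition induced : structure S := Structure nfun nrel neqv.

Hypothesis N_congr : congruence induced.
Hypothesis sat_dom : forall rho : nat -> M, sat rho (tr_dom tau).
Hypothesis sat_eq :
  forall rho : nat -> M, sat rho (tr_eq tau) <-> neqv (rho 0) (rho 1).
Hypothesis sat_fun : forall f (rho : nat -> M),
  sat rho (tr_fun tau f) <-> neqv (nfun (fun i : 'I_(far f) => rho i)) (rho (far f)).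
Hypothesis sat_rel : forall P (rho : nat -> M),
  sat rho (tr_rel tau P) <-> nrel (fun i : 'I_(rar P) => rho i).

Local Notation ev rho t := (@eval S induced rho t).

Lemma sat_dom_at (rho : nat -> M) x : sat rho (dom_at tau x).
Proof. by rewrite sat_subst; apply: sat_dom. Qed.

(** Common core of function graphs and relational atoms, with Q the intended meaning of the last
    conjunct q. The block of quantifiers disappears because each y_i is forced to be congruent to
    the value of the i-th argument, and Q respects congruence. *)
Lemma sat_unravel n (a : {ffun 'I_n -> term S}) (r : nat -> nat) (rho : nat -> M)
    (q : form T) (Q : ('I_n -> M) -> Prop) :
  (forall i r (rho : nat -> M) x,
     sat rho (graph tau r (a i) x) <-> neqv (ev (fun j => rho (r j)) (a i)) (rho x)) ->
  (forall v, sat (block n v rho) q <->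
             Q (fun i => block n v rho (arg_var r a i))) ->
  (forall b b', (forall i, neqv (b i) (b' i)) -> Q b -> Q b') ->
  sat rho (iter n (@Ex T) (And
    (\big[@And T/Top]_(i < n) if is_var (a i) then Top
       else And (dom_at tau i) (graph tau (fun j => r j + n) (a i) i)) q)) <->
  Q (fun i => ev (fun j => rho (r j)) (a i)).
Proof.
move=> graphP qQ Qcongr; rewrite sat_iter_Ex.
have conjP v (i : 'I_n) : sat (block n v rho) (if is_var (a i) then Top
       else And (dom_at tau i) (graph tau (fun j => r j + n) (a i) i)) <->
    neqv (ev (fun j => rho (r j)) (a i)) (block n v rho (arg_var r a i)).
  have [[j aj]|nv] : (exists j, a i = Var j) \/ is_var (a i) = false.
  - by case: (a i) => [j|]; [left; exists j|right].
  - rewrite /arg_var aj /= block_addn.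
    by split=> // _; apply: (seqv_refl N_congr).
  have -> : arg_var r a i = i by rewrite /arg_var; case: (a i) nv.
  rewrite nv (sat_And (P := True) (Q := _) _ (graphP _ _ _ _)); last first.
    by split=> // _; apply: sat_dom_at.
  have -> : (fun j => block n v rho (r j + n)) = (fun j => rho (r j)).
    by apply: funext => j; rewrite block_addn.
  by split=> [[]|].
have sym := seqv_sym N_congr.
split=> [[v]|h].
  rewrite (sat_And (iff_trans (sat_bigAnd _ _) (iff_refl _)) (qQ v)) => -[va].
  by apply: Qcongr => i; apply: sym; apply/conjP.
(* The witnesses are the values of the arguments; [block] never reads the filler beyond n. *)
pose v (k : nat) : M :=
  if insub k is Some i then ev (fun j => rho (r j)) (a i) else rho 0.
exists v.
have va (i : 'I_n) :
    neqv (ev (fun j => rho (r j)) (a i)) (block n v rho (arg_var r a i)).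
  rewrite /arg_var; case E: (a i) => [j|f b].
    by rewrite block_addn; apply: (seqv_refl N_congr).
  by rewrite /block ltn_ord /v valK E; apply: (seqv_refl N_congr).
apply/(sat_And (sat_bigAnd _ _) (qQ v)); split; first by move=> i; apply/conjP.
by apply: Qcongr h.
Qed.

Lemma sat_eq_at (rho : nat -> M) x y :
  sat rho (eq_at tau x y) <-> neqv (rho x) (rho y).
Proof. by rewrite /eq_at sat_subst sat_eq. Qed.

Lemma sat_graph t r (rho : nat -> M) x :
  sat rho (graph tau r t x) <-> neqv (ev (fun j => rho (r j)) t) (rho x).
Proof.
have [sym tr] := (seqv_sym N_congr, seqv_trans N_congr).
elim/term_rect_args: t r rho x => [i|f a IH] r rho x /=; first exact: sat_eq_at.
apply: (sat_unravel (Q := fun b => neqv (nfun b) (rho x))) => //.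
- move=> v; rewrite sat_subst sat_fun.
  have -> : insub (far f) = None :> option 'I_(far f) by rewrite insubN ?ltnn.
  rewrite [eval _ (Var (x + far f))]block_addn.
  have -> // : (fun i : 'I_(far f) => eval (block (far f) v rho)
    match insub (val i) with
    | Some j => Var (arg_var r a j)
    | None => Var (x + far f)
    end)
    = (fun i => block (far f) v rho (arg_var r a i)).
  by apply: funext => i; rewrite valK.
- move=> b b' bb' h; apply: tr _ h; apply: sym; exact: (sfun_congr N_congr).
Qed.

Lemma sat_translate_rel P a (rho : nat -> M) :
  sat rho (translate_rel tau (P := P) a) <-> nrel (fun i => ev rho (a i)).
Proof.
apply: (sat_unravel (r := id) (Q := @nrel P)) => [i r rho' x|v|b b' bb'].
- exact: sat_graph.
- rewrite sat_subst sat_rel.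
  have -> // : (fun i : 'I_(rar P) => eval (block (rar P) v rho)
    match insub (val i) with Some j => Var (arg_var id a j) | None => Var i end)
    = (fun i => block (rar P) v rho (arg_var id a i)).
  by apply: funext => i; rewrite valK.
- exact: (srel_congr N_congr).
Qed.

Lemma sat_translate p (rho : nat -> M) :
  sat rho (translate tau p) <-> @sat S induced rho p.
Proof.
have [sym tr] := (seqv_sym N_congr, seqv_trans N_congr).
elim: p rho => [|t u|P a|p IHp q IHq|p IH] rho //.
- have graphV w j : sat rho (graph tau id w j) <-> neqv (ev rho w) (rho j).
    exact: sat_graph.
  case: u => [j|g b]; first by case: t => *; apply: graphV.
  case: t => [i|f a].
    by apply: (iff_trans (graphV _ _)); split=> /sym.
  rewrite /translate /translate_eq.
  rewrite (sat_Ex (P := fun x =>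
    neqv (ev rho (App f a)) x /\ neqv (ev rho (App g b)) x)).
    split=> [[x [ax bx]]|ab]; first exact: tr ax (sym _ _ bx).
    by exists (ev rho (App g b)); split=> //; apply: (seqv_refl N_congr).
  move=> x; have domT : sat (scons x rho) (dom_at tau 0) <-> True.
    by split=> // _; apply: sat_dom_at.
  rewrite (sat_And domT (sat_And (sat_graph _ _ _ _) (sat_graph _ _ _ _))).
  by split=> [[]|].
- exact: sat_translate_rel.
- by rewrite /= IHp IHq.
- split=> h x; last by move=> _; apply/IH/h.
  exact: (iffLR (IH _) (h x (sat_dom_at _ _))).
Qed.

End TranslationSemantics.

(** * Cardinal arithmetic of finite sets without extensionality *)


Section SetNumbers.

Variables (M : Type) (mem : M -> M -> Prop).

Definition is_upair v a b := forall y, mem y v <-> (y = a \/ y = b).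

(** Kuratowski pairs. Without extensionality a pair may have many codes p, but each code still
    determines its components. *)
Definition is_pair p a b :=
  exists u v, is_upair p u v /\ (is_upair u a a /\ is_upair v a b).

Definition relates f a c := exists p, mem p f /\ is_pair p a c.

(** Further members of f are harmless, since only its pairs between x and y are inspected. The last
    clause expresses single-valuedness and injectivity at once. *)
Definition equinum x y := exists f,
  (forall a, mem a x -> exists c, mem c y /\ relates f a c) /\
  ((forall c, mem c y -> exists a, mem a x /\ relates f a c) /\
   (forall a c a' c', mem a x -> mem c y -> mem a' x -> mem c' y ->
     relates f a c -> relates f a' c' -> (a = a' <-> c = c'))).

Definition same_card b c := forall z, equinum b z <-> equinum c z.

(** The first disjunct covers elements that are not singletons, formal differences among them, so
    that this is an equivalence on the whole model. *)
Definition num_eq d d' := d = d' \/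
  exists b c, is_upair d b b /\ (is_upair d' c c /\ same_card b c).

Definition is_union a b e :=
  (forall w, mem w a -> ~ mem w b) /\
  (forall w, mem w e <-> (mem w a \/ mem w b)).

(** The last clause admits only one code for each pair, as otherwise s would have too many members.
    Going from s to e by [equinum] lets every finite set of the right size be a product. *)
Definition is_product a b e := exists s, equinum s e /\
  ((forall p, mem p s -> exists u v, mem u a /\ (mem v b /\ is_pair p u v)) /\
   ((forall u v, mem u a -> mem v b -> exists p, mem p s /\ is_pair p u v) /\
    (forall p p' u v, mem p s -> mem p' s ->
       is_pair p u v -> is_pair p' u v -> p = p'))).

(* Prescribing the whole equinumerosity class of [e] makes this functional and
   invariant for every [Phi]. *)
Definition class_op (Phi : M -> M -> M -> Prop) y z x := exists c d e,
  is_upair y c c /\ (is_upair z d d /\ (is_upair x e e /\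
  forall e', equinum e e' <->
    exists c' d', equinum c c' /\ (equinum d d' /\ Phi c' d' e'))).

(** Vacuous when s is not a singleton: anything may be subtracted from such an element. *)
Definition embeds y s := forall b, is_upair s b b ->
  exists c b', is_upair y c c /\ (equinum c b' /\ forall w, mem w b' -> mem w b).

(* A pair (s, t) serves as a formal difference s - t, so that every element
   outside the standard numbers is of the form z + n. The condition [embeds]
   keeps n - t from existing when t is not at most n. *)
Definition diff_add z y x := exists s t,
  is_pair z s t /\ (s <> t /\ (num_eq t y /\ (embeds t s /\ num_eq s x))).

Definition orelse (P Q : M -> M -> M -> Prop) z y x :=
  P z y x \/ (~ (exists x', P z y x') /\ Q z y x).

(** The choice of the second argument matters for addition: z + x = n by default then forces x to be
    n. *)
Definition snd_op (z y x : M) := num_eq y x.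

Definition num_add := orelse diff_add (orelse (class_op is_union) snd_op).
Definition num_mul := orelse (class_op is_product) snd_op.
Definition is_one o := exists b a, is_upair o b b /\ is_upair b a a.
Definition num_succ y x := exists o, is_one o /\ num_add y o x.
Definition num_zero x := exists b, is_upair x b b /\
  forall z, equinum b z <-> forall w, ~ mem w z.

Hypothesis finite_set : forall n (u : 'I_n -> M),
  exists x, forall y, mem y x <-> exists i, y = u i.

Lemma finite_image (I : finType) (u : I -> M) :
  exists x, forall y, mem y x <-> exists i, y = u i.
Proof.
have [x xP] := finite_set (fun i : 'I_#|I| => u (enum_val i)).
exists x => y; rewrite xP; split=> [[i ->]|[i ->]]; first by exists (enum_val i).
by exists (enum_rank i); rewrite enum_rankK.
Qed.

Lemma upair_ex a b : exists v, is_upair v a b.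
Proof.
have [v vP] := finite_image (fun i : bool => if i then a else b).
exists v => y; rewrite vP; split=> [[[] ->]|[]->]; [by left|by right|..].
- by exists true.
- by exists false.
Qed.

Lemma pair_ex a b : exists p, is_pair p a b.
Proof.
have [u uP] := upair_ex a a; have [v vP] := upair_ex a b.
by have [p pP] := upair_ex u v; exists p, u, v.
Qed.

Lemma upair1_inj d b c : is_upair d b b -> is_upair d c c -> b = c.
Proof. by move=> db /(_ b) dc; case: (iffLR dc) => //; apply/db; left. Qed.

(** Kuratowski's argument by membership alone: u and u' may be different sets with the same members,
    so equalities between sets come only from membership in p. *)
Lemma pair_inj p a b a' b' : is_pair p a b -> is_pair p a' b' -> a = a' /\ b = b'.
Proof.
move=> [u [v [p1 [u1 v1]]]] [u' [v' [p2 [u2 v2]]]].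
have up : mem u p by apply/p1; left.
have vp : mem v p by apply/p1; right.
have u'p : mem u' p by apply/p2; left.
have v'p : mem v' p by apply/p2; right.
have ab x : mem x v <-> x = a \/ x = b by apply: v1.
have ab' x : mem x v' <-> x = a' \/ x = b' by apply: v2.
have ua x : mem x u <-> x = a by rewrite (u1 x); tauto.
have ua' x : mem x u' <-> x = a' by rewrite (u2 x); tauto.
have aa' : a = a'.
  have au : mem a u by apply/ua.
  move/p2: up => [e|e].
    by move: au; rewrite e ua'.
  move: u'p => /p1[e'|e'].
    by move: au; rewrite -e' ua'.
  have : mem a' u by rewrite e ab'; left.
  by rewrite ua.
subst a'; split=> //.
have bv : mem b v by apply/ab; right.
have b'v' : mem b' v' by apply/ab'; right.
have bE : b = a \/ b = b'.
  by move/p2: vp bv => [->|->]; [rewrite ua'; left|rewrite ab'].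
have b'E : b' = a \/ b' = b.
  by move/p1: v'p b'v' => [->|->]; [rewrite ua; left|rewrite ab].
by case: bE => //; case: b'E => // -> ->.
Qed.

(** This separates formal differences, whose components are distinct, from the singletons that carry
    a cardinality. *)
Lemma pair_not_upair1 p a b c : is_pair p a b -> is_upair p c c -> a = b.
Proof.
move=> [u [v [p1 [u1 v1]]]] pc.
have uc : u = c by case: (iffLR (pc u)) => //; apply/p1; left.
have vc : v = c by case: (iffLR (pc v)) => //; apply/p1; right.
have : mem b u by rewrite uc -vc; apply/v1; right.
by rewrite (u1 b) => -[].
Qed.

Lemma num_eq_refl d : num_eq d d.
Proof. by left. Qed.

Lemma num_eq_sym d d' : num_eq d d' -> num_eq d' d.
Proof.
move=> [->|[b [c [db [dc bc]]]]]; first by left.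
by right; exists c, b; do 2!split=> //; move=> z; rewrite bc.
Qed.

Lemma num_eq_upair d d' b : num_eq d d' -> is_upair d b b ->
  exists c, is_upair d' c c /\ same_card b c.
Proof.
move=> [<-|[b' [c [db' [dc bc]]]]] db; first by exists b; split.
by exists c; rewrite (upair1_inj db db').
Qed.

Lemma num_eq_trans d d' d'' : num_eq d d' -> num_eq d' d'' -> num_eq d d''.
Proof.
move=> [->//|[b [c [db [dc bc]]]]] /num_eq_upair/(_ dc)[c' [dc' cc']].
by right; exists b, c'; do 2!split=> //; move=> z; rewrite bc.
Qed.

Definition functional (F : M -> M -> M -> Prop) := forall z y x x',
  F z y x -> F z y x' -> num_eq x x'.

Definition invariant (F : M -> M -> M -> Prop) := forall z y x z' y' x',
  num_eq z z' -> num_eq y y' -> num_eq x x' -> F z y x -> F z' y' x'.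

Definition total (F : M -> M -> M -> Prop) := forall z y, exists x, F z y x.

Definition operation F := [/\ functional F, invariant F & total F].

Lemma snd_operation : operation snd_op.
Proof.
split=> [z y x x' yx yx'|z y x z' y' x' _ yy' xx' yx|z y].
- exact: num_eq_trans (num_eq_sym yx) yx'.
- exact: num_eq_trans (num_eq_sym yy') (num_eq_trans yx xx').
- by exists y; left.
Qed.

Lemma orelse_operation P Q :
  functional P -> invariant P -> operation Q -> operation (orelse P Q).
Proof.
move=> Pf Pi [Qf Qi Qt]; split.
- move=> z y x x' [Pzyx|[nP Qzyx]] [Pzyx'|[nP' Qzyx']].
  + exact: Pf Pzyx Pzyx'.
  + by case: nP'; exists x.
  + by case: nP; exists x'.
  + exact: Qf Qzyx Qzyx'.
- move=> z y x z' y' x' zz' yy' xx' [Pzyx|[nP Qzyx]].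
    by left; apply: Pi Pzyx.
  right; split; last exact: Qi Qzyx.
  (* The absence of a P-value is invariant as well: a value at the new arguments is carried back by
     symmetry. *)
  move=> [w Pw]; apply: nP; exists w.
  by apply: Pi Pw; [apply: num_eq_sym|apply: num_eq_sym|left].
- move=> z y; have [[x Px]|nP] := EM (exists x, P z y x); first by exists x; left.
  by have [x Qx] := Qt z y; exists x; right.
Qed.

Lemma class_op_functional Phi : functional (class_op Phi).
Proof.
move=> z y x x' [c [d [e [zc [yd [xe eP]]]]]] [c' [d' [e' [zc' [yd' [xe' eP']]]]]].
rewrite -(upair1_inj zc zc') -(upair1_inj yd yd') in eP'.
by right; exists e, e'; do 2!split=> //; move=> w; rewrite eP eP'.
Qed.

Lemma class_op_invariant Phi : invariant (class_op Phi).
Proof.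
move=> z y x z' y' x' zz' yy' xx' [c [d [e [zc [yd [xe eP]]]]]].
have [c' [zc' cc']] := num_eq_upair zz' zc.
have [d' [yd' dd']] := num_eq_upair yy' yd.
have [e' [xe' ee']] := num_eq_upair xx' xe.
exists c', d', e'; do 3!split=> //; move=> w; rewrite -(ee' w) (eP w).
split=> -[u [v [cu [dv Puv]]]]; exists u, v.
  by rewrite -(cc' u) -(dd' v).
by rewrite (cc' u) (dd' v).
Qed.

Lemma diff_add_functional : functional diff_add.
Proof.
move=> z y x x' [s [t [zst [_ [_ [_ sx]]]]]] [s' [t' [zst' [_ [_ [_ sx']]]]]].
have [ss _] := pair_inj zst zst'; rewrite -ss in sx'.
exact: num_eq_trans (num_eq_sym sx) sx'.
Qed.

Lemma diff_add_invariant : invariant diff_add.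
Proof.
move=> z y x z' y' x' zz' yy' xx' [s [t [zst [st [ty [ts sx]]]]]].
(* A formal difference is no singleton, so it is identified with nothing but itself. *)
case: zz' => [<-|[b [c [zb _]]]]; last by case: st; apply: pair_not_upair1 zst zb.
exists s, t; do !split=> //; first exact: num_eq_trans ty yy'.
exact: num_eq_trans sx xx'.
Qed.

Lemma add_operation : operation num_add.
Proof.
apply: orelse_operation diff_add_functional diff_add_invariant _.
exact: orelse_operation (@class_op_functional _) (@class_op_invariant _) snd_operation.
Qed.

Lemma mul_operation : operation num_mul.
Proof.
exact: orelse_operation (@class_op_functional _) (@class_op_invariant _) snd_operation.
Qed.

(** * Externally finite sets and their sizes *)

Definition enumerated (I : finType) (P : M -> Prop) :=
  exists2 g : I -> M, injective g & forall y, P y <-> exists i, y = g i.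

Definition card x n := enumerated 'I_n (fun y => mem y x).

Definition std x n := exists2 b, is_upair x b b & card b n.

Lemma enumerated_transfer (I J : finType) P :
  #|I| = #|J| -> enumerated I P -> enumerated J P.
Proof.
move=> IJ [g g_inj gP]; pose h j := enum_val (cast_ord (esym IJ) (enum_rank j)).
exists (fun j => g (h j)).
  by move=> j j' /g_inj/enum_val_inj/cast_ord_inj/enum_rank_inj.
move=> y; rewrite gP; split=> [[i ->]|[j ->]]; last by exists (h j).
exists (enum_val (cast_ord IJ (enum_rank i))).
by rewrite /h enum_valK cast_ordK enum_rankK.
Qed.

Lemma enumerated_card (I : finType) x n :
  #|I| = n -> enumerated I (fun y => mem y x) <-> card x n.
Proof. by move=> In; split; apply: enumerated_transfer; rewrite card_ord. Qed.

Lemma enumerated_sub_card (I J : finType) (P Q : M -> Prop) :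
  enumerated I P -> enumerated J Q -> (forall y, P y -> Q y) -> #|I| <= #|J|.
Proof.
move=> [g g_inj gP] [h h_inj hQ] PQ.
have /choice[k kP] : forall i, exists j, g i = h j.
  by move=> i; apply/hQ/PQ/gP; exists i.
by apply: (leq_card k) => i i' kk; apply: g_inj; rewrite !kP kk.
Qed.

Lemma card_uniq x m n : card x m -> card x n -> m = n.
Proof.
move=> xm xn; apply/eqP; rewrite eqn_leq -(card_ord m) -(card_ord n).
by rewrite (enumerated_sub_card xm xn) // (enumerated_sub_card xn xm).
Qed.

Lemma sub_card x y n : card y n -> (forall w, mem w x -> mem w y) ->
  exists2 k, k <= n & card x k.
Proof.
move=> [g g_inj gP] xy; pose I : finType := {i : 'I_n | `[< mem (g i) x >]}.
have xI : enumerated I (fun w => mem w x).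
  exists (fun i : I => g (val i)); first by move=> i j /g_inj/val_inj.
  move=> w; split=> [wx|[[i /= /asboolP gx] ->]] //.
  have [i wi] := iffLR (gP w) (xy _ wx).
  by move: (wx); rewrite wi => /asboolP gx; exists (Sub i gx).
exists #|I|; last exact/(@enumerated_card I x _ erefl).
by rewrite card_sig -[n in _ <= n]card_ord max_card.
Qed.

(** Elements are picked one by one until n are found or P is exhausted. Stated for predicates, it
    applies both to the universe, which yields sets of every finite size, and to the members of a
    possibly infinite set. *)
Lemma large_or_enumerated (P : M -> Prop) n :
  (exists2 k, k < n & enumerated 'I_k P) \/
  (exists2 g : 'I_n -> M, injective g & forall i, P (g i)).
Proof.
elim: n => [|n [[k kn Pk]|[g g_inj gP]]].
- by right; exists (fun i : 'I_0 => False_rect M (notF (ltn_ord i))) => -[].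
- by left; exists k => //; apply: ltnW.
have [[y [Py ny]]|all] := EM (exists y, P y /\ forall i, y <> g i).
  right; exists (fun i => oapp g y (unlift ord_max i)).
    move=> i j; case: (unliftP ord_max i) => [i'|] ->;
      case: (unliftP ord_max j) => [j'|] -> //=.
    + by move/g_inj => ->.
    + by move/esym/ny.
    + by move/ny.
  by move=> i; case: (unliftP ord_max i) => [j|] _ /=.
left; exists n => //; exists g => // y; split=> [Py|[i ->]] //.
by apply: contrapT => ny; apply: all; exists y; split=> // i yi; apply: ny; exists i.
Qed.

(* Russell's argument: no finite list exhausts a model. *)
Lemma not_enumerated (I : finType) : ~ enumerated I (fun _ => True).
Proof.
move=> [g g_inj gP].
have [x xP] := finite_image
  (fun i : {i : I | `[< ~ mem (g i) (g i) >]} => g (val i)).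
have [j xj] := iffLR (gP x) Logic.I.
have nx : ~ mem x x.
  move=> xx; have [[i /= /asboolP ni] xi] := iffLR (xP x) xx.
  by apply: ni; rewrite -xi.
apply: (nx); apply/xP; move: nx; rewrite {1 2}xj => /asboolP gj.
by exists (Sub j gj).
Qed.

Lemma card_ex n : exists x, card x n.
Proof.
have [[k _ /not_enumerated]//|[g g_inj _]] := large_or_enumerated (fun _ => True) n.
by have [x xP] := finite_set g; exists x, g.
Qed.

Lemma std_ex n : exists x, std x n.
Proof. by have [b bn] := card_ex n; have [x xb] := upair_ex b b; exists x, b. Qed.

Lemma enumerated_equinum (I : finType) x y : enumerated I (fun w => mem w x) ->
  enumerated I (fun w => mem w y) -> equinum x y.
Proof.
move=> [g g_inj gP] [h h_inj hP].
have /choice[p pP] : forall i, exists p, is_pair p (g i) (h i).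
  by move=> i; apply: pair_ex.
have [f fP] := finite_image p.
(* By injectivity of pairs, f relates nothing beyond the intended matching. *)
have fE a c : relates f a c <-> exists i, a = g i /\ c = h i.
  split=> [[q [/fP[i ->] /(pair_inj (pP i))[<- <-]]]|[i [-> ->]]]; first by exists i.
  by exists (p i); split=> //; apply/fP; exists i.
exists f; split; [|split].
- by move=> a /gP[i ->]; exists (h i); rewrite hP fE; split; exists i.
- by move=> c /hP[i ->]; exists (g i); rewrite gP fE; split; exists i.
- move=> a c a' c' _ _ _ _ /fE[i [-> ->]] /fE[j [-> ->]].
  by split=> [/g_inj|/h_inj] ->.
Qed.

Lemma equinum_enumerated (I : finType) x y : equinum x y ->
  enumerated I (fun w => mem w x) -> enumerated I (fun w => mem w y).
Proof.
move=> [f [fx [fy f_inj]]] [g g_inj gP].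
have gx i : mem (g i) x by apply/gP; exists i.
have /choice[h hP] : forall i, exists c, mem c y /\ relates f (g i) c.
  by move=> i; apply/fx.
exists h.
  move=> i j hij; apply: g_inj; have [[yi fi] [yj fj]] := (hP i, hP j).
  exact: (iffRL (f_inj _ _ _ _ (gx i) yi (gx j) yj fi fj)).
move=> c; split=> [yc|[i ->]]; last by case: (hP i).
have [a [/gP[i ->] fc]] := fy c yc; exists i; have [yi fi] := hP i.
exact: (iffLR (f_inj _ _ _ _ (gx i) yc (gx i) yi fc fi)).
Qed.

Lemma equinum_enumerated_sym (I : finType) x y : equinum x y ->
  enumerated I (fun w => mem w y) -> enumerated I (fun w => mem w x).
Proof.
move=> [f [fx [fy f_inj]]] [g g_inj gP].
have gx i : mem (g i) y by apply/gP; exists i.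
have /choice[h hP] : forall i, exists a, mem a x /\ relates f a (g i).
  by move=> i; apply/fy.
exists h.
  move=> i j hij; apply: g_inj; have [[yi fi] [yj fj]] := (hP i, hP j).
  exact: (iffLR (f_inj _ _ _ _ yi (gx i) yj (gx j) fi fj)).
move=> a; split=> [xa|[i ->]]; last by case: (hP i).
have [c [/gP[i ->] fc]] := fx a xa; exists i; have [yi fi] := hP i.
exact: (iffRL (f_inj _ _ _ _ xa (gx i) yi (gx i) fc fi)).
Qed.

Lemma equinum_card x y n : card x n -> equinum x y <-> card y n.
Proof.
move=> xn; split=> [/equinum_enumerated|]; first exact.
exact: enumerated_equinum.
Qed.

(** A finite b is equinumerous to itself, so any c of the same class is equinumerous to b and has
    its size. *)
Lemma std_num_eq x y n : std x n -> num_eq x y <-> std y n.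
Proof.
move=> [b xb bn]; split=> [/num_eq_upair/(_ xb)[c [yc bc]]|[c yc cn]].
  by exists c => //; apply: (equinum_enumerated_sym _ bn); apply/bc/(equinum_card _ bn).
right; exists b, c; do 2!split=> //; move=> z.
by rewrite (equinum_card _ bn) (equinum_card _ cn).
Qed.

Lemma std_uniq x m n : std x m -> std x n -> m = n.
Proof.
move=> [b xb bm] [c xc cn]; rewrite -(upair1_inj xb xc) in cn.
exact: card_uniq bm cn.
Qed.

Lemma union_card a b e m n :
  card a m -> card b n -> is_union a b e -> card e (m + n).
Proof.
move=> [g g_inj gP] [h h_inj hP] [dis eP].
apply/(enumerated_card (I := 'I_m + 'I_n)%type); first by rewrite card_sum !card_ord.
exists (fun k => match k with inl i => g i | inr j => h j end).
  have gh i j : g i <> h j.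
    by move=> gh; apply: (dis (g i)); [apply/gP; exists i|apply/hP; exists j].
  move=> [i|j] [i'|j'] //; first by move/g_inj => ->.
  - by move/gh.
  - by move/esym/gh.
  - by move/h_inj => ->.
move=> w; rewrite eP gP hP; split=> [[[i ->]|[j ->]]|[[i|j] ->]].
- by exists (inl i).
- by exists (inr j).
- by left; exists i.
- by right; exists j.
Qed.

Lemma union_ex e m n : card e (m + n) ->
  exists a b, [/\ card a m, card b n & is_union a b e].
Proof.
move/(enumerated_card (I := 'I_m + 'I_n)%type) => [|g g_inj gP].
  by rewrite card_sum !card_ord.
have [a aP] := finite_set (fun i : 'I_m => g (inl i)).
have [b bP] := finite_set (fun j : 'I_n => g (inr j)).
exists a, b; split.
- by exists (fun i => g (inl i)) => // i j /g_inj[].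
- by exists (fun i => g (inr i)) => // i j /g_inj[].
- split=> [w /aP[i ->] /bP[j /g_inj]|w] //.
  rewrite gP aP bP; split=> [[[i|j] ->]|[[i ->]|[j ->]]].
  + by left; exists i.
  + by right; exists j.
  + by exists (inl i).
  + by exists (inr j).
Qed.

Lemma product_card a b e m n :
  card a m -> card b n -> is_product a b e <-> card e (m * n).
Proof.
move=> [g g_inj gP] [h h_inj hP].
have ga i : mem (g i) a by apply/gP; exists i.
have hb j : mem (h j) b by apply/hP; exists j.
have cardIJ : #|{: 'I_m * 'I_n}| = m * n by rewrite card_prod !card_ord.
rewrite -(enumerated_card e cardIJ); split=> [[s [se [sP [sab s_inj]]]]|eP].
  apply: (equinum_enumerated se).
  have /choice[p pP] : forall ij : 'I_m * 'I_n,
      exists p, mem p s /\ is_pair p (g ij.1) (h ij.2).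
    by move=> ij; apply: sab.
  exists p.
    move=> [i j] [i' j'] pp; have [_ p1] := pP (i, j); have [_ p2] := pP (i', j').
    by rewrite pp in p1; have [/g_inj /= -> /h_inj /= ->] := pair_inj p1 p2.
  move=> w; split=> [ws|[ij ->]]; last by case: (pP ij).
  have [u [v [/gP[i ui] [/hP[j vj] wuv]]]] := sP w ws.
  exists (i, j); have [ps pij] := pP (i, j); apply: (s_inj _ _ u v) => //.
  by rewrite ui vj.
have /choice[p pP] : forall ij : 'I_m * 'I_n,
    exists p, is_pair p (g ij.1) (h ij.2).
  by move=> ij; apply: pair_ex.
have [s sP] := finite_image p.
exists s; split.
  apply: enumerated_equinum eP; exists p => // -[i j] [i' j'] pp.
  have := pP (i, j); rewrite pp => /(pair_inj (pP (i', j')))[].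
  by move=> /g_inj /= -> /h_inj /= ->.
split; [|split].
- by move=> _ /sP[ij ->]; exists (g ij.1), (h ij.2).
- move=> u v /gP[i ->] /hP[j ->]; exists (p (i, j)); split; last exact: pP (i, j).
  by apply/sP; exists (i, j).
- move=> _ _ u v /sP[[i j] ->] /sP[[i' j'] ->].
  move=> /(pair_inj (pP _))[/= <- <-] /(pair_inj (pP _))[/g_inj /= -> /h_inj /= ->].
  by [].
Qed.

(** * The operations on standard numbers *)

Lemma class_op_std Phi m n k y z x :
  (forall a b e, card a m -> card b n -> Phi a b e -> card e k) ->
  (forall e, card e k -> exists a b, [/\ card a m, card b n & Phi a b e]) ->
  std y m -> std z n -> class_op Phi y z x <-> std x k.
Proof.
move=> Phi_card Phi_ex [c yc cm] [d zd dn]; split.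
  move=> [c' [d' [e [yc' [zd' [xe eP]]]]]]; exists e => //.
  rewrite -(upair1_inj yc yc') -(upair1_inj zd zd') in eP.
  (* A set of size k lies in the class prescribed for [e], so [e] is equinumerous to it and has size
     k itself. *)
  have [e' e'k] := card_ex k; apply: (equinum_enumerated_sym _ e'k).
  have [a [b [am bn ab]]] := Phi_ex _ e'k; apply/eP; exists a, b.
  by rewrite (equinum_card _ cm) (equinum_card _ dn).
move=> [e xe ek]; exists c, d, e; do 3!split=> //; move=> w.
rewrite (equinum_card _ ek); split=> [/Phi_ex[a [b [am bn ab]]]|[a [b]]].
  by exists a, b; rewrite (equinum_card _ cm) (equinum_card _ dn).
rewrite (equinum_card _ cm) (equinum_card _ dn).
by move=> [am [bn]]; apply: Phi_card.
Qed.

Lemma class_op_orelse_std Phi Q m n k y z x :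
  (forall a b e, card a m -> card b n -> Phi a b e -> card e k) ->
  (forall e, card e k -> exists a b, [/\ card a m, card b n & Phi a b e]) ->
  std y m -> std z n -> orelse (class_op Phi) Q y z x <-> std x k.
Proof.
move=> Phi_card Phi_ex ym zn.
have opP w := @class_op_std Phi m n k y z w Phi_card Phi_ex ym zn.
split=> [[/opP//|[[]]]|/opP]; last by left.
by have [w wk] := std_ex k; exists w; apply/opP.
Qed.

Lemma add_std z y x m n : std z m -> std y n -> num_add z y x <-> std x (m + n).
Proof.
move=> zm yn; rewrite -(class_op_orelse_std snd_op x
  (fun a b e => @union_card a b e m n) (fun e => @union_ex e m n) zm yn).
(* [diff_add] cannot apply, because the standard z is a singleton. *)
split=> [[|[]]//|]; last first.
  right; split=> // -[x' [s [t [zst [st _]]]]].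
  by case: zm => b zb _; apply/st/(pair_not_upair1 zst zb).
move=> [s [t [zst [st _]]]].
by case: zm => b zb _; case: st; apply: pair_not_upair1 zst zb.
Qed.

Lemma mul_std z y x m n : std z m -> std y n -> num_mul z y x <-> std x (m * n).
Proof.
apply: class_op_orelse_std => [a b e am bn /(product_card _ am bn)//|e ek].
have [[a am] [b bn]] := (card_ex m, card_ex n).
by exists a, b; split=> //; apply/(product_card _ am bn).
Qed.

Lemma one_std o : is_one o -> std o 1.
Proof.
move=> [b [a [ob ba]]]; exists b => //; exists (fun=> a).
  by move=> i j _; rewrite !ord1.
move=> y; rewrite (ba y); split=> [[]->|[_ ->]]; [by exists ord0..|by left].
Qed.

Lemma one_ex : exists o, is_one o.
Proof.
have [a _] := card_ex 0.
have [b ba] := upair_ex a a; have [o ob] := upair_ex b b.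
by exists o, b, a.
Qed.

Lemma succ_std y x n : std y n -> num_succ y x <-> std x n.+1.
Proof.
move=> yn; rewrite -addn1; split=> [[o [/one_std o1]]|xn].
  by rewrite (add_std _ yn o1).
by have [o oP] := one_ex; exists o; rewrite (add_std _ yn (one_std oP)).
Qed.

Lemma succ_total y : exists x, num_succ y x.
Proof.
have [o oP] := one_ex; have [_ _ add_t] := add_operation.
by have [x yox] := add_t y o; exists x, o.
Qed.

Lemma succ_invariant y x y' x' : num_eq y y' -> num_eq x x' ->
  num_succ y x -> num_succ y' x'.
Proof.
have [_ add_i _] := add_operation.
move=> yy' xx' [o [oP yox]]; exists o; split=> //.
exact: add_i (num_eq_refl o) xx' yox.
Qed.

(** Many elements may serve as the number one, but all of them are [std] of 1 and thus identified by
    [num_eq], under which addition is invariant. *)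
Lemma succ_functional y x x' : num_succ y x -> num_succ y x' -> num_eq x x'.
Proof.
have [add_f add_i _] := add_operation.
move=> [o [/one_std oP yox]] [o' [/one_std oP' yox']]; apply: add_f yox _.
by apply: add_i yox' => //; [left|apply/(std_num_eq _ oP')|left].
Qed.

Lemma zero_std x : num_zero x <-> std x 0.
Proof.
have emptyP z : card z 0 <-> forall w, ~ mem w z.
  split=> [[g _ gP] w /gP[[]]//|z0].
  exists (fun i : 'I_0 => False_rect M (notF (ltn_ord i))) => [[]//|w].
  by split=> [/z0|[[]]].
split=> [[b [xb bP]]|[b xb b0]]; exists b => //.
  have [z z0] := card_ex 0; apply: (equinum_enumerated_sym _ z0).
  exact/bP/emptyP.
by split=> // z; rewrite (equinum_card _ b0) emptyP.
Qed.

(** This is what the axiom on x <= n requires. In each of the three ways a sum can arise, x is a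
    standard number of size at most n; for a formal difference, [embeds] supplies a subset of the
    n-element set equinumerous to the set of x. *)
Lemma add_std_inv z x y n : num_add z x y -> std y n ->
  exists2 k, k <= n & std x k.
Proof.
move=> zxy yn; case: zxy => [[s [t [_ [_ [tx [ts sy]]]]]]|[_]].
  have [b sb bn] := iffLR (std_num_eq s yn) (num_eq_sym sy).
  have [c [b' [tc [cb' b'b]]]] := ts b sb.
  have [k kn b'k] := sub_card bn b'b; exists k => //.
  have tk : std t k by exists c => //; apply: (equinum_enumerated_sym _ b'k).
  exact/(std_num_eq _ tk).
(* By default x equals y. For a genuine sum, the finite [e] belongs to its own class, so it is a
   union of two parts, one of them equinumerous to the set of x. *)
case=> [[c [d [e [zc [xd [ye eP]]]]]]|[_ xy]]; last first.
  by exists n => //; apply/(std_num_eq _ yn)/num_eq_sym.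
have {yn}[e' ye' en] := yn; rewrite -(upair1_inj ye ye') in en.
have [|c' [d' [_ [dd' [_ eU]]]]] := iffLR (eP e); first exact/(equinum_card _ en).
have [|k kn d'k] := sub_card (x := d') en; first by move=> w wd; apply/eU; right.
by exists k => //; exists d => //; apply: (equinum_enumerated_sym _ d'k).
Qed.

Lemma std_or_diff x n : (exists2 k, k < n & std x k) \/
  forall y, std y n -> exists z, num_add z y x.
Proof.
(* The case x = n is settled here by adding zero, because a formal difference needs distinct
   components. *)
have [small|large] := EM (exists2 k, k <= n & std x k).
  have {small}[k] := small; rewrite leq_eqVlt => /orP[/eqP->|kn] xk.
    right=> y yn; have [z z0] := std_ex 0; exists z.
    by apply/(add_std _ z0 yn).
  by left; exists k.
(* The pair of x and y is itself the difference x - y. *)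
right=> y yn; have [z zxy] := pair_ex x y; exists z; left; exists x, y.
split=> //; split; first by move=> xy; apply: large; exists n; rewrite ?xy //.
split; first by left.
split; last by left.
move=> b xb; have [c yc cn] := yn.
(* If x is the singleton of b, then b has at least n members, and any n of them form a set by finite
   comprehension, whether or not b is finite. *)
have [[k kn bk]|[g g_inj gb]] := large_or_enumerated (fun w => mem w b) n.
  by case: large; exists k; [apply: ltnW|exists b].
have [b' b'P] := finite_set g; exists c, b'; split=> //; split.
  by apply/(equinum_card _ cn); exists g.
by move=> w /b'P[i ->].
Qed.

End SetNumbers.

(** * The translation *)


Local Notation mem_ x y := (Mem (Var x) (Var y)).
Local Notation eq_ x y := (@Eq set_sig (Var x) (Var y)).

(* The arguments are the de Bruijn indices of the variables. *)
Definition fupair v a b :=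
  All (Iff (mem_ 0 v.+1) (Or (eq_ 0 a.+1) (eq_ 0 b.+1))).
Definition fpair p a b :=
  Ex (Ex (And (fupair p.+2 1 0) (And (fupair 1 a.+2 a.+2) (fupair 0 a.+2 b.+2)))).
Definition frelates f a c := Ex (And (mem_ 0 f.+1) (fpair 0 a.+1 c.+1)).
Definition fequinum x y := Ex (And
  (All (Imp (mem_ 0 x.+2) (Ex (And (mem_ 0 y.+3) (frelates 2 1 0))))) (And
  (All (Imp (mem_ 0 y.+2) (Ex (And (mem_ 0 x.+3) (frelates 2 0 1)))))
  (All (All (All (All (Imp (mem_ 3 x.+4.+1) (Imp (mem_ 2 y.+4.+1)
    (Imp (mem_ 1 x.+4.+1) (Imp (mem_ 0 y.+4.+1)
    (Imp (frelates 4 3 2) (Imp (frelates 4 1 0)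
    (Iff (eq_ 3 1) (eq_ 2 0)))))))))))))).
Definition fsame_card b c := All (Iff (fequinum b.+1 0) (fequinum c.+1 0)).
Definition fnum_eq d d' := Or (eq_ d d')
  (Ex (Ex (And (fupair d.+2 1 1) (And (fupair d'.+2 0 0) (fsame_card 1 0))))).
Definition funion a b e := And
  (All (Imp (mem_ 0 a.+1) (Not (mem_ 0 b.+1))))
  (All (Iff (mem_ 0 e.+1) (Or (mem_ 0 a.+1) (mem_ 0 b.+1)))).
Definition fproduct a b e := Ex (And (fequinum 0 e.+1) (And
  (All (Imp (mem_ 0 1)
    (Ex (Ex (And (mem_ 1 a.+4) (And (mem_ 0 b.+4) (fpair 2 1 0))))))) (And
  (All (All (Imp (mem_ 1 a.+3) (Imp (mem_ 0 b.+3)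
    (Ex (And (mem_ 0 3) (fpair 0 2 1)))))))
  (All (All (All (All (Imp (mem_ 3 4) (Imp (mem_ 2 4)
    (Imp (fpair 3 1 0) (Imp (fpair 2 1 0) (eq_ 3 2)))))))))))).
Definition fclass_op (Phi : nat -> nat -> nat -> form set_sig) y z x :=
  Ex (Ex (Ex (And (fupair y.+3 2 2) (And (fupair z.+3 1 1) (And (fupair x.+3 0 0)
    (All (Iff (fequinum 1 0)
      (Ex (Ex (And (fequinum 5 1) (And (fequinum 4 0) (Phi 1 0 2)))))))))))).
Definition fembeds y s := All (Imp (fupair s.+1 0 0)
  (Ex (Ex (And (fupair y.+3 1 1) (And (fequinum 1 0)
    (All (Imp (mem_ 0 1) (mem_ 0 3)))))))).
Definition fdiff_add z y x := Ex (Ex (And (fpair z.+2 1 0) (And (Not (eq_ 1 0))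
  (And (fnum_eq 0 y.+2) (And (fembeds 0 1) (fnum_eq 1 x.+2)))))).
Definition forelse (P Q : nat -> nat -> nat -> form set_sig) z y x :=
  Or (P z y x) (And (Not (Ex (P z.+1 y.+1 0))) (Q z y x)).
Definition fsnd_op (z y x : nat) := fnum_eq y x.
Definition fadd := forelse fdiff_add (forelse (fclass_op funion) fsnd_op).
Definition fmul := forelse (fclass_op fproduct) fsnd_op.
Definition fone o := Ex (Ex (And (fupair o.+2 1 1) (fupair 1 0 0))).
Definition fsucc y x := Ex (And (fone 0) (fadd y.+1 0 x.+1)).
Definition fzero x := Ex (And (fupair x.+1 0 0)
  (All (Iff (fequinum 1 0) (All (Not (mem_ 0 1)))))).

(** * Free variables of the formulas *)

Lemma bounded_mem n x y : x < n -> y < n -> bounded n (mem_ x y).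
Proof.
move=> hx hy; apply/forallP=> i; rewrite /args ffunE.
by case: (unliftP ord0 i) => [j ->|->] //; rewrite !ord1.
Qed.

Lemma bounded_eq n x y : x < n -> y < n -> bounded n (eq_ x y).
Proof. by move=> /= -> ->. Qed.

Lemma bounded_Imp n (p q : form set_sig) :
  bounded n p -> bounded n q -> bounded n (Imp p q).
Proof. by move=> /= -> ->. Qed.

Lemma bounded_Not n (p : form set_sig) : bounded n p -> bounded n (Not p).
Proof. by move=> /= ->. Qed.

Lemma bounded_And n (p q : form set_sig) :
  bounded n p -> bounded n q -> bounded n (And p q).
Proof. by move=> /= -> ->. Qed.

Lemma bounded_Or n (p q : form set_sig) :
  bounded n p -> bounded n q -> bounded n (Or p q).
Proof. by move=> /= -> ->. Qed.

Lemma bounded_Iff n (p q : form set_sig) :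
  bounded n p -> bounded n q -> bounded n (Iff p q).
Proof. by move=> /= -> ->. Qed.

Lemma bounded_Ex n (p : form set_sig) : bounded n.+1 p -> bounded n (Ex p).
Proof. by move=> /= ->. Qed.

Lemma bounded_All n (p : form set_sig) : bounded n.+1 p -> bounded n (All p).
Proof. by []. Qed.

Create HintDb bounded discriminated.
#[local] Hint Constants Opaque : bounded.
#[local] Hint Resolve bounded_mem bounded_eq bounded_Imp bounded_Not bounded_And
  bounded_Or bounded_Iff bounded_Ex bounded_All : bounded.
#[local] Hint Extern 0 (is_true (_ < _)) => done : bounded.

Definition bounded2 (F : nat -> nat -> form set_sig) :=
  forall n x y, x < n -> y < n -> bounded n (F x y).

Definition bounded3 (F : nat -> nat -> nat -> form set_sig) :=
  forall n x y z, x < n -> y < n -> z < n -> bounded n (F x y z).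

Ltac bounded_by F :=
  rewrite /bounded2 /bounded3 /F; intros; solve [auto 60 with bounded].

Lemma bounded_fupair : bounded3 fupair.
Proof. bounded_by fupair. Qed.
#[local] Hint Resolve bounded_fupair : bounded.

Lemma bounded_fpair : bounded3 fpair.
Proof. bounded_by fpair. Qed.
#[local] Hint Resolve bounded_fpair : bounded.

Lemma bounded_frelates : bounded3 frelates.
Proof. bounded_by frelates. Qed.
#[local] Hint Resolve bounded_frelates : bounded.

Lemma bounded_fequinum : bounded2 fequinum.
Proof. bounded_by fequinum. Qed.
#[local] Hint Resolve bounded_fequinum : bounded.

Lemma bounded_fsame_card : bounded2 fsame_card.
Proof. bounded_by fsame_card. Qed.
#[local] Hint Resolve bounded_fsame_card : bounded.

Lemma bounded_fnum_eq : bounded2 fnum_eq.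
Proof. bounded_by fnum_eq. Qed.
#[local] Hint Resolve bounded_fnum_eq : bounded.

Lemma bounded_funion : bounded3 funion.
Proof. bounded_by funion. Qed.
#[local] Hint Resolve bounded_funion : bounded.

Lemma bounded_fproduct : bounded3 fproduct.
Proof. bounded_by fproduct. Qed.
#[local] Hint Resolve bounded_fproduct : bounded.

Lemma bounded_fembeds : bounded2 fembeds.
Proof. bounded_by fembeds. Qed.
#[local] Hint Resolve bounded_fembeds : bounded.

Lemma bounded_fdiff_add : bounded3 fdiff_add.
Proof. bounded_by fdiff_add. Qed.
#[local] Hint Resolve bounded_fdiff_add : bounded.

Lemma bounded_fclass_op F : bounded3 F -> bounded3 (fclass_op F).
Proof. bounded_by fclass_op. Qed.

Lemma bounded_forelse F G : bounded3 F -> bounded3 G -> bounded3 (forelse F G).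
Proof. bounded_by forelse. Qed.

Lemma bounded_fsnd_op : bounded3 fsnd_op.
Proof. bounded_by fsnd_op. Qed.

Lemma bounded_fadd : bounded3 fadd.
Proof.
apply: bounded_forelse bounded_fdiff_add (bounded_forelse _ bounded_fsnd_op).
exact: bounded_fclass_op bounded_funion.
Qed.
#[local] Hint Resolve bounded_fadd : bounded.

Lemma bounded_fmul : bounded3 fmul.
Proof. exact: bounded_forelse (bounded_fclass_op bounded_fproduct) bounded_fsnd_op. Qed.

Lemma bounded_fone n o : o < n -> bounded n (fone o).
Proof. bounded_by fone. Qed.
#[local] Hint Resolve bounded_fone : bounded.

Lemma bounded_fsucc : bounded2 fsucc.
Proof. bounded_by fsucc. Qed.

Lemma bounded_fzero n x : x < n -> bounded n (fzero x).
Proof. bounded_by fzero. Qed.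

Definition arith_formula (f : arith_fsym) : form set_sig :=
  match f with
  | ZeroSym => fzero 0
  | SuccSym => fsucc 0 1
  | AddSym => fadd 0 1 2
  | MulSym => fmul 0 1 2
  end.

Lemma arith_formula_bounded f : bounded (arith_far f).+1 (arith_formula f).
Proof.
case: f; [exact: bounded_fzero|exact: bounded_fsucc|..].
  exact: bounded_fadd.
exact: bounded_fmul.
Qed.

(** The operations are total on all elements of a model, so the domain is unrestricted. *)
Definition arith_translation : translation arith_sig set_sig :=
  @Translation arith_sig set_sig Top (fnum_eq 0 1) arith_formula
    (fun P => match P with end) isT
    (@bounded_fnum_eq 2 0 1 isT isT) arith_formula_bounded
    (fun P => match P with end).

(** * Meaning of the formulas in models with genuine equality *)

Section Model.

Variable M : structure set_sig.
Hypothesis M_normal : forall x y, seqv M x y <-> x = y.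
Implicit Type rho : nat -> M.

Definition smem (x y : M) : Prop := srel M MemSym (tnth [tuple x; y]).

Lemma sat_mem rho i j : sat rho (mem_ i j) <-> smem (rho i) (rho j).
Proof.
rewrite /smem /=; set a := fun k => _.
suff -> : a = tnth [tuple rho i; rho j] by [].
apply: funext => k; rewrite /a /args ffunE.
by case: (unliftP ord0 k) => [l ->|->] //; rewrite !ord1.
Qed.

Lemma sat_eqv rho i j : sat rho (eq_ i j) <-> rho i = rho j.
Proof. exact: M_normal. Qed.

Definition sat2 (F : nat -> nat -> form set_sig) (P : M -> M -> Prop) :=
  forall rho x y, sat rho (F x y) <-> P (rho x) (rho y).

Definition sat3 (F : nat -> nat -> nat -> form set_sig) (P : M -> M -> M -> Prop) :=
  forall rho x y z, sat rho (F x y z) <-> P (rho x) (rho y) (rho z).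

(** Formulas and predicates agree connective by connective, including the nesting of conjunctions,
    so the meaning is found by recursion on the formula. *)
Ltac sat_step := lazymatch goal with
  | |- sat _ (Mem _ _) <-> _ => exact: sat_mem
  | |- sat _ (Iff _ _) <-> _ => apply: sat_Iff
  | |- sat _ (And _ _) <-> _ => apply: sat_And
  | |- sat _ (Or _ _) <-> _ => apply: sat_Or
  | |- sat _ (Not _) <-> _ => apply: sat_Not
  | |- sat _ (Ex _) <-> _ => apply: sat_Ex => ?
  | |- sat _ (All _) <-> _ => apply: sat_All => ?
  | |- sat _ (Imp _ _) <-> _ => apply: sat_Imp
  | |- sat _ (Eq _ _) <-> _ => exact: sat_eqv
  | H : sat3 ?F _ |- sat _ (?F _ _ _) <-> _ => exact: H
  | H : sat2 ?F _ |- sat _ (?F _ _) <-> _ => exact: H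
  end.

Lemma sat_fupair : sat3 fupair (is_upair smem).
Proof. move=> *; rewrite /fupair; repeat sat_step. Qed.

Lemma sat_fpair : sat3 fpair (is_pair smem).
Proof.
have h0 := sat_fupair;
move=> *; rewrite /fpair; repeat sat_step.
Qed.

Lemma sat_frelates : sat3 frelates (relates smem).
Proof.
have h0 := sat_fpair;
move=> *; rewrite /frelates; repeat sat_step.
Qed.

Lemma sat_fequinum : sat2 fequinum (equinum smem).
Proof.
have h0 := sat_frelates;
move=> *; rewrite /fequinum; repeat sat_step.
Qed.

Lemma sat_fsame_card : sat2 fsame_card (same_card smem).
Proof.
have h0 := sat_fequinum;
move=> *; rewrite /fsame_card; repeat sat_step.
Qed.

Lemma sat_fnum_eq : sat2 fnum_eq (num_eq smem).
Proof.
have h0 := sat_fupair; have h1 := sat_fsame_card;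
move=> *; rewrite /fnum_eq; repeat sat_step.
Qed.

Lemma sat_funion : sat3 funion (is_union smem).
Proof. move=> *; rewrite /funion; repeat sat_step. Qed.

Lemma sat_fproduct : sat3 fproduct (is_product smem).
Proof.
have h0 := sat_fpair; have h1 := sat_fequinum;
move=> *; rewrite /fproduct; repeat sat_step.
Qed.

Lemma sat_fembeds : sat2 fembeds (embeds smem).
Proof.
have h0 := sat_fupair; have h1 := sat_fequinum;
move=> *; rewrite /fembeds; repeat sat_step.
Qed.

Lemma sat_fdiff_add : sat3 fdiff_add (diff_add smem).
Proof.
have h0 := sat_fpair; have h1 := sat_fnum_eq; have h2 := sat_fembeds;
move=> *; rewrite /fdiff_add; repeat sat_step.
Qed.

Lemma sat_fclass_op F Phi : sat3 F Phi -> sat3 (fclass_op F) (class_op smem Phi).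
Proof.
have h0 := sat_fupair; have h1 := sat_fequinum.
move=> FP rho y z x; rewrite /fclass_op; repeat sat_step.
Qed.

Lemma sat_forelse F G P Q :
  sat3 F P -> sat3 G Q -> sat3 (forelse F G) (orelse P Q).
Proof. move=> FP GQ rho z y x; rewrite /forelse; repeat sat_step. Qed.

Lemma sat_fsnd_op : sat3 fsnd_op (snd_op smem).
Proof. by move=> *; apply: sat_fnum_eq. Qed.

Lemma sat_fadd : sat3 fadd (num_add smem).
Proof.
apply: sat_forelse sat_fdiff_add (sat_forelse _ sat_fsnd_op).
exact: sat_fclass_op sat_funion.
Qed.

Lemma sat_fmul : sat3 fmul (num_mul smem).
Proof. exact: sat_forelse (sat_fclass_op sat_fproduct) sat_fsnd_op. Qed.

Lemma sat_fone rho o : sat rho (fone o) <-> is_one smem (rho o).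
Proof. have h0 := sat_fupair; rewrite /fone; repeat sat_step. Qed.

Lemma sat_fsucc : sat2 fsucc (num_succ smem).
Proof.
move=> *; apply: sat_Ex => o; apply: sat_And; [exact: sat_fone|exact: sat_fadd].
Qed.

Lemma sat_fzero rho x : sat rho (fzero x) <-> num_zero smem (rho x).
Proof.
have h0 := sat_fupair; have h1 := sat_fequinum.
rewrite /fzero; repeat sat_step.
Qed.

End Model.

(** * The interpretation *)


Lemma bounded_iter_All (S : signature) m n (p : form S) :
  bounded m (iter n (@All S) p) = bounded (n + m) p.
Proof. by elim: n m => //= n IH m; rewrite IH addnS. Qed.

Lemma bounded_bigOr (S : signature) m n (F : 'I_n -> form S) :
  (forall i, bounded m (F i)) -> bounded m (\big[@Or S/Bot]_(i < n) F i).
Proof. by move=> b; elim/big_ind: _ => //= p q -> ->. Qed.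

Lemma VS_sentence q : VS q -> sentence q.
Proof.
case=> [|n].
  by apply: bounded_Ex; apply: bounded_All; apply: bounded_Not; apply: bounded_mem.
rewrite /sentence bounded_iter_All addn0.
apply: bounded_Ex; apply: bounded_All; apply: bounded_Iff.
  exact: bounded_mem.
by apply: bounded_bigOr => i; apply: bounded_eq; rewrite ?ltnS ?ltn_ord.
Qed.

Definition var_index (t : term set_sig) : nat :=
  match t with Var i => i | App f _ => match f with end end.

Lemma var_indexK : cancel var_index Var.
Proof. by case=> // -[]. Qed.

(** The Henkin construction needs an enumeration of all formulas; it comes from the countability of
    finite trees labelled by naturals, terms being mere variables here. *)
Fixpoint form_encode (p : form set_sig) : GenTree.tree nat :=
  match p with
  | Bot => GenTree.Node 0 [::]
  | Eq t u => GenTree.Node 1 [:: GenTree.Leaf (var_index t); GenTree.Leaf (var_index u)]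
  | Rel P a =>
      match P return {ffun 'I_(@rar set_sig P) -> _} -> _ with
      | MemSym => fun a => GenTree.Node 2
          [:: GenTree.Leaf (var_index (a ord0)); GenTree.Leaf (var_index (a ord_max))]
      end a
  | Imp p q => GenTree.Node 3 [:: form_encode p; form_encode q]
  | All p => GenTree.Node 4 [:: form_encode p]
  end.

Fixpoint form_decode (t : GenTree.tree nat) : form set_sig :=
  match t with
  | GenTree.Node 1 [:: GenTree.Leaf i; GenTree.Leaf j] => Eq (Var i) (Var j)
  | GenTree.Node 2 [:: GenTree.Leaf i; GenTree.Leaf j] => Mem (Var i) (Var j)
  | GenTree.Node 3 [:: p; q] => Imp (form_decode p) (form_decode q)
  | GenTree.Node 4 [:: p] => All (form_decode p)
  | _ => Bot
  end.

Lemma form_encodeK : cancel form_encode form_decode.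
Proof.
elim=> //= [t u|[] a|p -> q ->|p ->] //=; first by rewrite !var_indexK.
rewrite !var_indexK; congr Rel; apply/ffunP=> i; rewrite /args ffunE.
case: (unliftP ord0 i) => [j ->|->] //=; rewrite ord1.
by congr (a _); apply: val_inj.
Qed.

Definition form_enum (n : nat) : form set_sig :=
  odflt Bot (omap form_decode (unpickle n)).

Lemma form_enum_onto p : exists n, form_enum n = p.
Proof.
by exists (pickle (form_encode p)); rewrite /form_enum pickleK /= form_encodeK.
Qed.

Section Interpretation.

Variables (M : structure set_sig) (rho0 : nat -> M).
Hypothesis M_normal : forall x y, seqv M x y <-> x = y.
Hypothesis M_VS : forall (rho : nat -> M) q, VS q -> sat rho q.

Local Notation num_eq := (num_eq (@smem M)).
Local Notation std := (std (@smem M)).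

Lemma VS_finite_set n (u : 'I_n -> M) :
  exists x, forall y, smem y x <-> exists i, y = u i.
Proof.
(* Only the first n entries are read; [rho0 0] is filler. *)
pose v k := if insub k is Some i then u i else rho0 0.
have := iffLR (sat_iter_All _ _ _) (M_VS rho0 (VS_ax_set n)) v.
apply: (iffLR (sat_Ex _)) => x; apply: sat_All => y; apply: sat_Iff.
  exact: sat_mem.
apply: (iff_trans (sat_bigOr _ _)).
have bv (i : 'I_n) : block n v rho0 i = u i by rewrite /block ltn_ord /v valK.
split=> -[i yi]; exists i; first by rewrite -bv; apply/M_normal.
by apply/M_normal; rewrite /= bv.
Qed.

Definition arith_op (f : arith_fsym) : ('I_(arith_far f) -> M) -> M -> Prop :=
  match f with
  | ZeroSym => fun _ => num_zero (@smem M)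
  | SuccSym => fun a => num_succ (@smem M) (a ord0)
  | AddSym => fun a => num_add (@smem M) (a ord0) (a ord_max)
  | MulSym => fun a => num_mul (@smem M) (a ord0) (a ord_max)
  end.

Lemma arith_op_total f (a : 'I_(arith_far f) -> M) : exists x, arith_op a x.
Proof.
have fin := VS_finite_set; case: f a => a /=.
- by have [x x0] := std_ex fin 0; exists x; apply/(zero_std fin).
- exact: succ_total.
- by case: (add_operation (@smem M)).
- by case: (mul_operation (@smem M)).
Qed.

Lemma arith_op_functional f (a : 'I_(arith_far f) -> M) x x' :
  arith_op a x -> arith_op a x' -> num_eq x x'.
Proof.
have fin := VS_finite_set; case: f a => a /=.
- by move=> /(zero_std fin) x0 /(zero_std fin) x0'; apply/(std_num_eq fin _ x0).
- exact: succ_functional.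
- by case: (add_operation (@smem M)) => h _ _; apply: h.
- by case: (mul_operation (@smem M)) => h _ _; apply: h.
Qed.

Lemma arith_op_invariant f (a a' : 'I_(arith_far f) -> M) x x' :
  (forall i, num_eq (a i) (a' i)) -> num_eq x x' ->
  arith_op a x -> arith_op a' x'.
Proof.
have fin := VS_finite_set; case: f a a' => a a' aa' xx' /=.
- by move/(zero_std fin) => x0; apply/(zero_std fin)/(std_num_eq fin _ x0).
- exact: succ_invariant.
- by case: (add_operation (@smem M)) => _ h _; apply: h.
- by case: (mul_operation (@smem M)) => _ h _; apply: h.
Qed.

(** An arbitrary value is chosen, since the operation fixes its value only up to [num_eq]. *)
Definition arith_fun (f : fsym arith_sig) (a : 'I_(far f) -> M) : M :=
  projT1 (cid (arith_op_total a)).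

Lemma arith_funP (f : fsym arith_sig) (a : 'I_(far f) -> M) x :
  @arith_op f a x <-> num_eq (arith_fun a) x.
Proof.
rewrite /arith_fun; case: cid => w /= aw; split=> [|wx].
  exact: arith_op_functional.
by apply: arith_op_invariant wx aw => i; left.
Qed.

Definition numbers : structure arith_sig :=
  @induced arith_sig set_sig M arith_fun (fun P => match P with end) num_eq.

Lemma numbers_congruence : congruence numbers.
Proof.
split=> /=; [exact: num_eq_refl|exact: num_eq_sym|exact: num_eq_trans|..|by case].
move=> f a b ab; apply/arith_funP.
apply: arith_op_invariant (num_eq_refl _ _) _; last exact/arith_funP/num_eq_refl.
by move=> i; apply: num_eq_sym.
Qed.

Local Notation nsat := (@sat arith_sig numbers).
Local Notation neval := (@eval arith_sig numbers).

Lemma sat_numbers p (rho : nat -> M) :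
  sat rho (translate arith_translation p) <-> nsat rho p.
Proof.
apply: sat_translate.
- exact: numbers_congruence.
- by move=> r [].
- by move=> r; apply: sat_fnum_eq.
- move=> f r; rewrite -arith_funP; case: f => /=.
  + exact: sat_fzero.
  + exact: sat_fsucc.
  + exact: sat_fadd.
  + exact: sat_fmul.
- by case.
Qed.

Lemma neval_add (rho : nat -> M) t u x :
  num_eq (neval rho (Add t u)) x <->
  num_add (@smem M) (neval rho t) (neval rho u) x.
Proof. by rewrite -arith_funP /= !ffunE. Qed.

Lemma neval_mul (rho : nat -> M) t u x :
  num_eq (neval rho (Mul t u)) x <->
  num_mul (@smem M) (neval rho t) (neval rho u) x.
Proof. by rewrite -arith_funP /= !ffunE. Qed.

Lemma std_numeral (rho : nat -> M) n : std (neval rho (numeral n)) n.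
Proof.
have fin := VS_finite_set; elim: n => [|n IH].
  apply/(zero_std fin).
  exact: (iffRL (@arith_funP ZeroSym _ _) (num_eq_refl _ _)).
apply/(succ_std fin _ IH).
have := iffRL (@arith_funP SuccSym _ _) (num_eq_refl _ (neval rho (numeral n.+1))).
by rewrite /= ffunE.
Qed.

Lemma nsat_le (rho : nat -> M) t u : nsat rho (Le t u) <->
  exists z, num_add (@smem M) z (neval rho t) (neval rho u).
Proof.
apply: sat_Ex => z; apply: (iff_trans (neval_add _ _ _ _)).
by rewrite !eval_tshift.
Qed.

Lemma nsat_R (rho : nat -> M) q : R q -> nsat rho q.
Proof.
have fin := VS_finite_set; have num := std_numeral.
case=> [m n|m n|m n mn|n|n].
- by apply/neval_add/(add_std fin _ (num _ _) (num _ _)).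
- by apply/neval_mul/(mul_std fin _ (num _ _) (num _ _)).
- move/(std_num_eq fin _ (num rho m)) => nm; apply: mn.
  exact: std_uniq nm (num rho n).
- move=> x /nsat_le[z zx]; apply/sat_bigOr.
  have [k kn xk] := add_std_inv fin zx (num _ n).
  by exists (Ordinal (kn : k < n.+1)); apply/(std_num_eq fin _ xk).
- move=> x; apply/(sat_Or (nsat_le _ _ _) (nsat_le _ _ _)).
  have [[k kn xk]|h] := std_or_diff fin x n; last by right; apply/h/num.
  left; have [z zn] := std_ex fin (n - k); exists z.
  by apply/(add_std fin _ zn xk); rewrite subnK ?(ltnW kn).
Qed.

End Interpretation.

(** The whole derivation from [R] is evaluated in [numbers], a structure with a congruence;
    soundness thereby also accounts for the translated laws of identity and for totality and
    functionality of the symbols. *)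
Theorem theorem2p2 : interprets_1d VS R.
Proof.
exists arith_translation => p _ [G GR d].
apply: completeness VS_sentence form_enum_onto _ => M M_normal M_VS rho.
apply/(sat_numbers rho M_normal M_VS).
apply: (soundness (numbers_congruence rho M_normal M_VS) d) => q Gq.
exact/nsat_R/GR.
Qed.
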